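(* Let $N\ge 2$, $N\neq 3$, $1^*=\frac{N}{N-1}$ and $q\in(1,1^* )$. For $r>0$ let $\Omega_r=\{x\in\mathbb{R}^N : r<|x|<r+1\}$. For each $n\in\mathbb{N}$ there exist $r_0>0$ and $\lambda_0>0$ such that for all $\lambda\ge\lambda_0$ and all $r\ge r_0$, the problem $$-\Delta_1 u+\frac{u}{|u|}=\lambda|u|^{q-2}u+|u|^{1^*-2}u \ \text{ in }\Omega_r,\qquad u=0\ \text{ on }\partial\Omega_r,$$ has at least $n$ nonradial and (pairwise) rotationally non-equivalent solutions.
   Context: $BV(\Omega_r)$ is the space of functions of bounded variation on $\Omega_r$, $\int_{\Omega_r}|Du|$ is the total variation of $Du$, boundary values are taken in the sense of traces, and $\mathcal{H}^{N-1}$ is the $(N-1)$-dimensional Hausdorff measure. A function $u\in BV(\Omega_r)$ is a solution of the problem if there are $z\in L^\infty(\Omega_r,\mathbb{R}^N)$ and $\gamma\in L^\infty(\Omega_r,\mathbb{R})$ such that: $|z|_\infty\le 1$, $\operatorname{div} z\in L^N(\Omega_r)$ (distributional divergence), $-\int_{\Omega_r}u\,\operatorname{div}z\,dx=\int_{\Omega_r}|Du|+\int_{\partial\Omega_r}|u|\,d\mathcal{H}^{N-1}$; $|\gamma|_\infty\le 1$ and $\gamma|u|=u$ a.e. in $\Omega_r$; and $-\operatorname{div}z+\gamma=\lambda|u|^{q-2}u+|u|^{1^*-2}u$ a.e. in $\Omega_r$. A function $u$ on $\Omega_r$ is radial if $u=u\circ g$ a.e. for every $g\in O(N)$, and nonradial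 otherwise. Two functions $u,v$ on $\Omega_r$ are rotationally non-equivalent if there is no $g\in O(N)$ with $v=u\circ g$ a.e. in $\Omega_r$. *)

(* Defs.v *)
From HB Require Import structures.
From mathcomp Require Import all_boot all_order all_algebra.
From mathcomp Require Import all_classical all_reals all_analysis.

Set Implicit Arguments.
Unset Strict Implicit.
Unset Printing Implicit Defensive.

Import Order.TTheory GRing.Theory Num.Theory.
Import numFieldNormedType.Exports.

Local Open Scope classical_set_scope.
Local Open Scope ring_scope.

(* Points of R^N are row vectors; the norm of the library on 'rV[R]_N is the
   sup norm, whence the Euclidean norm below. *)
Definition enorm (R : realType) (N : nat) (x : 'rV[R]_N) : R :=
  Num.sqrt (\sum_(i < N) x 0 i ^+ 2).

Definition eball (R : realType) (N : nat) (x : 'rV[R]_N) (rho : R) :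
  set 'rV[R]_N := [set y | enorm (y - x) < rho].

(* A copy of T in which every set is measurable, so that [mu_ext] takes the
   infimum over all the countable covers. *)
Definition all_measurable (T : Type) : Type := T.

HB.instance Definition _ (T : pointedType) := Pointed.on (all_measurable T).
HB.instance Definition _ (T : pointedType) := @isMeasurable.Build
  default_measure_display (all_measurable T) discrete_measurable
  discrete_measurable0 discrete_measurableC discrete_measurableU.

Section cover_outer.
Context (R : realType) (T : pointedType).
Local Open Scope ereal_scope.

(* inf { \sum_k tau (C k) | A `<=` \bigcup_k C k }, where empty sets in the
   cover cost nothing whatever the value of [tau set0]. *)
Definition cover_outer (tau : set T -> \bar R) : set T -> \bar R :=
  @mu_ext _ (all_measurable T) R
    (fun A => if `[< A = set0 >] then 0 else tau A).

Variable tau : set T -> \bar R.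
Hypothesis tau_ge0 : forall A, 0 <= tau A.

Let tau' (A : set (all_measurable T)) := if `[< A = set0 >] then 0 else tau A.

Let tau'0 : tau' set0 = 0.
Proof. by rewrite /tau' asboolT. Qed.

Let tau'_ge0 A : 0 <= tau' A.
Proof. by rewrite /tau'; case: ifP. Qed.

Lemma cover_outer0 : cover_outer tau set0 = 0.
Proof. exact: (mu_ext0 tau'0 tau'_ge0). Qed.

Lemma cover_outer_ge0 A : 0 <= cover_outer tau A.
Proof. exact: (mu_ext_ge0 tau'_ge0). Qed.

Lemma le_cover_outer : {homo cover_outer tau : A B / A `<=` B >-> A <= B}.
Proof. exact: (@le_mu_ext _ (all_measurable T) R tau'). Qed.

Lemma cover_outer_sigma_subadditive : sigma_subadditive (cover_outer tau).
Proof. exact: (@mu_ext_sigma_subadditive _ (all_measurable T) R tau' tau'_ge0). Qed.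

End cover_outer.

Definition caratheodory_measure (R : realType) (T : pointedType)
    (mu : {outer_measure set T -> \bar R}) :
    {measure set (caratheodory_type mu) -> \bar R} :=
  [the measure _ _ of (mu : set (caratheodory_type mu) -> \bar R)].

Section lebesgue.
Context (R : realType) (N : nat).
Local Open Scope ereal_scope.

Definition box (a b : 'rV[R]_N) : set 'rV[R]_N :=
  [set x | forall i, (a 0 i <= x 0 i <= b 0 i)%R].

(* The infimum is +oo when A is not a box. *)
Definition box_volume (A : set 'rV[R]_N) : \bar R :=
  ereal_inf [set v | exists a b : 'rV[R]_N,
    [/\ forall i, (a 0 i <= b 0 i)%R, A = box a b &
        v = (\prod_(i < N) (b 0 i - a 0 i))%:E]].

Definition lebesgue_outer : set 'rV[R]_N -> \bar R := cover_outer box_volume.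

Lemma box_volume_ge0 A : 0 <= box_volume A.
Proof.
apply: le_ereal_inf_tmp => _ [a [b [ab _ ->]]].
by rewrite lee_fin prodr_ge0// => i _; rewrite subr_ge0.
Qed.

HB.instance Definition _ := isOuterMeasure.Build R 'rV[R]_N lebesgue_outer
  (cover_outer0 box_volume_ge0) (cover_outer_ge0 box_volume_ge0)
  (@le_cover_outer _ _ box_volume)
  (cover_outer_sigma_subadditive box_volume_ge0).

Definition lebesgueN := caratheodory_measure lebesgue_outer.

End lebesgue.

Section hausdorff.
Context (R : realType) (m N : nat).
Local Open Scope ereal_scope.

Definition diam (A : set 'rV[R]_N) : \bar R :=
  ereal_sup ([set 0] `|`
    [set d | exists x y, [/\ A x, A y & d = (enorm (x - y))%:E]]).

(* The normalizing constant is the volume of the unit ball of R^m. *)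
Definition hausdorff_gauge (delta : R) (A : set 'rV[R]_N) : \bar R :=
  if diam A <= delta%:E
  then lebesgueN R m [set x | (enorm x <= 1)%R] * (2^-1%:E * diam A) ^+ m
  else +oo.

Definition hausdorff_outer (A : set 'rV[R]_N) : \bar R :=
  ereal_sup [set cover_outer (hausdorff_gauge delta) A |
             delta in [set delta | (0 < delta)%R]].

Lemma hausdorff_gauge_ge0 delta A : 0 <= hausdorff_gauge delta A.
Proof.
rewrite /hausdorff_gauge; case: ifP => // _.
rewrite mule_ge0// expe_ge0// mule_ge0 ?lee_fin ?invr_ge0//.
by apply: ereal_sup_ubound; left.
Qed.

Let gauge_ge0 := hausdorff_gauge_ge0.

Lemma le_hausdorff delta A : (0 < delta)%R ->
  cover_outer (hausdorff_gauge delta) A <= hausdorff_outer A.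
Proof. by move=> d0; apply: ereal_sup_ubound; exists delta. Qed.

Lemma hausdorff_outer_ge0 A : 0 <= hausdorff_outer A.
Proof.
apply: (@le_trans _ _ (cover_outer (hausdorff_gauge 1) A)).
  exact: cover_outer_ge0 (gauge_ge0 1) _.
exact: le_hausdorff.
Qed.

Lemma hausdorff_outer0 : hausdorff_outer set0 = 0.
Proof.
apply/eqP; rewrite eq_le hausdorff_outer_ge0 andbT.
apply: ge_ereal_sup => _ [delta _ <-].
by rewrite (cover_outer0 (gauge_ge0 delta)).
Qed.

Lemma le_hausdorff_outer :
  {homo hausdorff_outer : A B / A `<=` B >-> A <= B}.
Proof.
move=> A B AB; apply: ge_ereal_sup => _ [delta d0 <-].
exact: (le_trans (le_cover_outer _ AB) (le_hausdorff B d0)).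
Qed.

Lemma hausdorff_outer_sigma_subadditive : sigma_subadditive hausdorff_outer.
Proof.
move=> F; apply: ge_ereal_sup => _ [delta d0 <-].
apply: le_trans (cover_outer_sigma_subadditive (gauge_ge0 delta) F) _.
apply: lee_nneseries => [i _ _|i _]; last exact: le_hausdorff.
exact: cover_outer_ge0 (gauge_ge0 delta) _.
Qed.

HB.instance Definition _ := isOuterMeasure.Build R 'rV[R]_N hausdorff_outer
  hausdorff_outer0 hausdorff_outer_ge0 le_hausdorff_outer
  hausdorff_outer_sigma_subadditive.

Definition hausdorff := caratheodory_measure hausdorff_outer.

End hausdorff.

Section functions.
Context (R : realType) (N : nat).
Implicit Types (D : set 'rV[R]_N) (f u : 'rV[R]_N -> R).
Local Notation leb := (lebesgueN R N).

Definition partial (i : 'I_N) f : 'rV[R]_N -> R :=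
  fun x => 'D_(delta_mx 0 i) f x.

Fixpoint Ck (k : nat) f : Prop :=
  continuous f /\
  if k is k'.+1 then
    forall i : 'I_N, (forall x, derivable f x (delta_mx 0 i)) /\
                     Ck k' (partial i f)
  else True.

Definition compact_support_in D f : Prop :=
  let supp := closure [set x | f x != 0] in compact supp /\ supp `<=` D.

Definition divergence (phi : 'rV[R]_N -> 'rV[R]_N) (x : 'rV[R]_N) : R :=
  \sum_(i < N) partial i (fun y => phi y 0 i) x.

Definition gradient_variation D u : \bar R :=
  ereal_sup [set (\int[leb]_(x in D) (u x * divergence phi x)%:E)%E |
    phi in [set phi : 'rV[R]_N -> 'rV[R]_N |
      (forall i : 'I_N, Ck 1 (fun y => phi y 0 i) /\
                        compact_support_in D (fun y => phi y 0 i)) /\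
      (forall x, enorm (phi x) <= 1)]].

Definition BV D u : Prop :=
  leb.-integrable D (EFin \o u) /\ (gradient_variation D u < +oo)%E.

Definition measurable_on D f : Prop :=
  measurable_fun (D : set (caratheodory_type (@lebesgue_outer R N))) f.

Definition norm_p D (p : \bar R) f : \bar R :=
  Lnorm leb p (EFin \o (f \_ D)).

Definition distributional_div D (z : 'rV[R]_N -> 'rV[R]_N)
    (w : 'rV[R]_N -> R) : Prop :=
  forall phi : 'rV[R]_N -> R,
    (forall k, Ck k phi) -> compact_support_in D phi ->
    ((\int[leb]_(x in D) (\sum_(i < N) z x 0%R i * partial i phi x)%R%:E) =
     - (\int[leb]_(x in D) (w x * phi x)%:E))%E.

Definition bdry D : set 'rV[R]_N := closure D `\` interior D.

(* t is the trace on the boundary of D of the BV function u: for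
   H^(N-1)-almost every boundary point x,
   rho^(-N) \int_(D `&` B(x, rho)) |u(y) - t(x)| dy --> 0 as rho --> 0+. *)
Definition is_trace D u (t : 'rV[R]_N -> R) : Prop :=
  (hausdorff R N.-1 N).-integrable (bdry D) (EFin \o t) /\
  (\forall x \ae hausdorff R N.-1 N, bdry D x ->
    (((rho ^- N)%:E *
       \int[leb]_(y in D `&` eball x rho) `|u y - t x|%:E)%E
     @[rho --> 0^'+] --> 0%E)).

End functions.

Section problem.
Context (R : realType) (N : nat).
Implicit Types (D : set 'rV[R]_N) (u v : 'rV[R]_N -> R).
Local Notation leb := (lebesgueN R N).

Definition annulus (r : R) : set 'rV[R]_N :=
  [set x | r < enorm x < r + 1].

Definition crit_exp : R := N%:R / (N%:R - 1).

(* w stands for div z and t for the trace of u.  The terms |u|^(s-2) u vanish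
   where u does, whatever the value of the power of 0. *)
Definition is_solution (lambda q : R) D u : Prop :=
  BV D u /\
  exists (z : 'rV[R]_N -> 'rV[R]_N) (gamma w t : 'rV[R]_N -> R),
    [/\ (forall i : 'I_N, measurable_on D (fun x => z x 0 i)) /\
        (norm_p D +oo%E (fun x => enorm (z x)) <= 1)%E,
        [/\ distributional_div D z w, measurable_on D w &
            (norm_p D N%:R%:E w < +oo)%E],
        is_trace D u t /\
        (- (\int[leb]_(x in D) (u x * w x)%:E) =
         gradient_variation D u +
         \int[hausdorff R N.-1 N]_(x in bdry D) `|t x|%:E)%E,
        [/\ measurable_on D gamma, (norm_p D +oo%E gamma <= 1)%E &
            \forall x \ae leb, D x -> gamma x * `|u x| = u x] &
        \forall x \ae leb, D x ->
          - w x + gamma x = lambda * `|u x| `^ (q - 2) * u x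
                            + `|u x| `^ (crit_exp - 2) * u x].

(* Points are row vectors, so that g acts by x |-> x *m g. *)
Definition orthogonal_mx (g : 'M[R]_N) : Prop := g *m g^T = 1%:M.

Definition radial D u : Prop :=
  forall g : 'M[R]_N, orthogonal_mx g ->
    \forall x \ae leb, D x -> u x = u (x *m g).

Definition rot_equivalent D u v : Prop :=
  exists g : 'M[R]_N, orthogonal_mx g /\
    \forall x \ae leb, D x -> v x = u (x *m g).

End problem.

(* Main.v *)
(* Multiples [c * \1_B] of indicators of balls are explicit solutions. If B has
   centre a and radius rho, then z(x) = - (x - a) / rho inside B, continued by
   the divergence-free field - rho^(N-1) (x - a) / |x - a|^N, satisfies |z| <= 1
   and div z = - (N / rho) \1_B, and the perimeter of B is (N / rho) |B|; so the
   problem reduces to lambda c^(q-1) + c^(1*-1) = 1 + N / rho, which is solvable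
   for every lambda > 0. Balls centred on the sphere of radius r + 1/2 fit into
   the annulus as soon as rho < 1/2; they are not radial, and distinct radii give
   distinct values of c, hence rotationally non-equivalent solutions.

   Integration by parts uses only the translation invariance of Lebesgue measure:
   the difference quotients of a compactly supported function integrate to 0. *)
Require Import Defs.
From mathcomp Require Import all_boot all_order all_algebra.
From mathcomp Require Import all_classical all_reals all_analysis.
From mathcomp Require Import measurable_realfun.
From mathcomp Require Import ring lra.

Set Implicit Arguments.
Unset Strict Implicit.
Unset Printing Implicit Defensive.

Import Order.TTheory GRing.Theory Num.Theory.
Import numFieldNormedType.Exports.

Local Open Scope classical_set_scope.
Local Open Scope ring_scope.

(** * Lebesgue measure of boxes and translation invariance *)

(** Neither [\1_B] nor the field z is C^1, and no Gauss-Green formula on the ball is used. Each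
    identity is proved for C^1 approximations, by parts against functions of compact support, and
    passes to the limit by dominated convergence. Upper bound for the perimeter: replace [\1_B] by a
    radial cutoff and move the derivative of the test field Phi onto it. The gradient of the cutoff
    lives where |x - a| >= rho, and there Phi . (x - a) <= |x - a| <= |x - a|^2 / rho; so Phi may be
    replaced by (x - a) / rho, whose divergence is the constant N / rho, and the derivative moves
    back. Lower bound: (x - a) / rho2, cut off between the radii rho and rho2, with rho2 tending to
    rho. The volume of B is never computed. Its positivity matters only for extracting a point of B
    from an almost-everywhere statement. Radial functions are written in the variable |x - a|^2, a
    polynomial, so that the centre is not singular. Each ball stays away from the boundary of the
    annulus, so the trace is 0. *)

Section lebesgue_outer.
Context (R : realType) (N : nat).
Implicit Types (A : set 'rV[R]_N) (a b : 'rV[R]_N).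
Local Open Scope ereal_scope.

Lemma le_box_volume a b : (forall i, (a 0 i <= b 0 i)%R) ->
  box_volume (box a b) <= (\prod_(i < N) (b 0 i - a 0 i))%:E.
Proof. by move=> ab; apply: ereal_inf_lbound; exists a, b. Qed.

Lemma lebesgue_outer_le A (a b : nat -> 'rV[R]_N) :
  (forall k i, (a k 0 i <= b k 0 i)%R) ->
  A `<=` \bigcup_k box (a k) (b k) ->
  lebesgue_outer A <= \sum_(k <oo) (\prod_(i < N) (b k 0 i - a k 0 i))%:E.
Proof.
move=> ab Aab; rewrite /lebesgue_outer /cover_outer.
apply: (@le_trans _ _ (\sum_(k <oo)
  (if `[< box (a k) (b k) = set0 >] then 0 else box_volume (box (a k) (b k))))).
  by apply: ereal_inf_lbound; exists (fun k => box (a k) (b k)).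
apply: lee_nneseries => [k _ _|k _]; case: ifP => // _; rewrite ?box_volume_ge0//.
  by rewrite lee_fin prodr_ge0// => i _; rewrite subr_ge0.
exact: le_box_volume.
Qed.

(** A cover of finite total cost has pieces of finite cost only, and these are boxes or empty. So
    near-optimal covers may be taken to consist of genuine boxes, given by their corners. *)
Lemma lebesgue_outer_lt A x : (0 < N)%N -> lebesgue_outer A < x ->
  exists a b : nat -> 'rV[R]_N, [/\ (forall k i, (a k 0 i <= b k 0 i)%R),
    A `<=` \bigcup_k box (a k) (b k) &
    \sum_(k <oo) (\prod_(i < N) (b k 0 i - a k 0 i))%:E < x].
Proof.
move=> N0 /ereal_inf_lt[_ [F [_ AF] <-] Fx].
pose tau B := if `[< B = set0 >] then 0 else @box_volume R N B.
have {}Fx : \sum_(k <oo) tau (F k) < x := Fx.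
have tau_ge0 B : 0 <= tau B by rewrite /tau; case: ifP => // _; exact: box_volume_ge0.
have tau_fin k : tau (F k) < +oo.
  rewrite ltey; apply/negP => /eqP Fk.
  move: Fx; rewrite ltNge => /negP; apply.
  suff -> : \sum_(k <oo) tau (F k) = +oo by rewrite leey.
  by apply: (nneseries_pinfty _ _ Fk) => // i _.
have /choice[f fP] k : exists p : 'rV[R]_N * 'rV[R]_N,
  [/\ (forall i, (p.1 0 i <= p.2 0 i)%R), F k `<=` box p.1 p.2 &
      (\prod_(i < N) (p.2 0 i - p.1 0 i))%:E <= tau (F k)].
  have := tau_fin k; rewrite /tau; case: asboolP => [-> _|Fk0].
    (* An empty piece becomes the one-point box at the origin; as [N] is positive, its volume is a
       product with a factor 0. *)
    exists (0, 0)%R; split => //=.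
    by case: N N0 => // n _; rewrite big_ord_recl /= subrr mul0r.
  move=> /ereal_inf_lt[_ [a [b [ab Fab ->]] _]].
  exists (a, b); split => //=; first by rewrite Fab.
  (* A nonempty box determines its corners: each pair of corners lies in the box spanned by the
     other. Hence all representations have the same volume. *)
  apply: le_ereal_inf_tmp => _ [a' [b' [ab' Fab' ->]]].
  rewrite Fab in Fab'.
  have ba' : box a b a' by rewrite Fab' => i; rewrite lexx ab'.
  have bb' : box a b b' by rewrite Fab' => i; rewrite lexx ab'.
  have ba : box a' b' a by rewrite -Fab' => i; rewrite lexx ab.
  have bb : box a' b' b by rewrite -Fab' => i; rewrite lexx ab.
  rewrite lee_fin ler_prod// => i _; rewrite subr_ge0 ab /=.
  by move: (ba' i) (bb' i) (ba i) (bb i); lra.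
exists (fst \o f), (snd \o f); split.
- by move=> k i; have [] := fP k.
- by move=> y /AF[k _ Fky]; exists k => //; have [_ + _] := fP k; exact.
- apply: le_lt_trans Fx; apply: lee_nneseries => [k _ _|k _] /=.
    rewrite lee_fin prodr_ge0// => i _; rewrite subr_ge0.
    by have [+ _ _] := fP k.
  by have [] := fP k.
Qed.

End lebesgue_outer.

Section lebesgue_measurable.
Context (R : realType) (N : nat).
Hypothesis N_gt0 : (0 < N)%N.
Implicit Types (A : set 'rV[R]_N) (a b : 'rV[R]_N).
Local Open Scope ereal_scope.
Local Notation mu := (@lebesgue_outer R N).
Local Notation T := (caratheodory_type mu).

(** The hyperplane cuts each box of a near-optimal cover into two boxes whose volumes add up
    exactly. Points of the hyperplane may lie on either side, which treats open and closed
    half-spaces together. *)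
Lemma halfspace_caratheodory (i : 'I_N) (h : R) (S : set 'rV[R]_N) :
  (forall x, S x -> (x 0 i <= h)%R) -> (forall x, ~ S x -> (h <= x 0 i)%R) ->
  mu.-caratheodory S.
Proof.
move=> Sh NSh; apply: le_caratheodory_measurable => X.
change (mu (X `&` S) + mu (X `&` ~` S) <= mu X); apply/lee_addgt0Pr => e e0.
have [Xoo|Xoo] := eqVneq (mu X) +oo; first by rewrite Xoo addye// leey.
have Xfin : mu X \is a fin_num.
  by rewrite ge0_fin_numE ?ltey//; exact: outer_measure_ge0.
have : mu X < mu X + e%:E by rewrite lteDl// lte_fin.
move=> /(lebesgue_outer_lt N_gt0)[a [b [ab Xab abe]]].
(* [h] clamped to the side of the box: if the hyperplane misses the box, one of the two pieces is
   degenerate. *)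
pose m k := (Num.max (a k 0 i) (Num.min (b k 0 i) h))%R.
have am k : (a k 0 i <= m k)%R by rewrite /m le_max lexx.
have mb k : (m k <= b k 0 i)%R by rewrite /m ge_max ab ge_min lexx.
pose b' k : 'rV[R]_N := (\row_j if j == i then m k else b k 0 j)%R.
pose a' k : 'rV[R]_N := (\row_j if j == i then m k else a k 0 j)%R.
apply: le_trans (ltW abe).
apply: (@le_trans _ _ (\sum_(k <oo) (\prod_(j < N) (b' k 0 j - a k 0 j))%:E +
  \sum_(k <oo) (\prod_(j < N) (b k 0 j - a' k 0 j))%:E)).
  apply: leeD; apply: lebesgue_outer_le.
  - by move=> k j; rewrite mxE; case: eqP => [->|].
  - move=> x [/Xab[k _ xk] Sx]; exists k => // j; rewrite mxE.
    case: eqP => [->|_]; last exact: xk.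
    have /andP[xa xb] := xk i; rewrite xa/= le_max le_min xb/= (Sh _ Sx).
    by rewrite orbT.
  - by move=> k j; rewrite mxE; case: eqP => [->|].
  - move=> x [/Xab[k _ xk] Sx]; exists k => // j; rewrite mxE.
    case: eqP => [->|_]; last exact: xk.
    have /andP[xa xb] := xk i; rewrite xb andbT ge_max xa/= ge_min.
    by rewrite (NSh _ Sx) orbT.
rewrite -nneseriesD; last 2 first.
- move=> k _ _; rewrite lee_fin prodr_ge0// => j _; rewrite mxE subr_ge0.
  by case: eqP => [->|].
- move=> k _ _; rewrite lee_fin prodr_ge0// => j _; rewrite mxE subr_ge0.
  by case: eqP => [->|].
apply: lee_nneseries => [k _ _|k _].
  by rewrite -EFinD lee_fin addr_ge0// prodr_ge0// => j _; rewrite mxE subr_ge0;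
    case: eqP => [->|].
rewrite -EFinD lee_fin (bigD1 i)//= [X in (_ + X)%R](bigD1 i)//=.
rewrite [leRHS](bigD1 i)//= !mxE eqxx.
rewrite (eq_bigr (fun j => b k 0 j - a k 0 j)%R); last first.
  by move=> j /negPf ji; rewrite mxE ji.
rewrite [X in (_ + _ * X)%R](eq_bigr (fun j => b k 0 j - a k 0 j)%R); last first.
  by move=> j /negPf ji; rewrite mxE ji.
by rewrite -mulrDl addrC addrA subrK.
Qed.

Local Close Scope ereal_scope.

Lemma measurable_box a b : measurable (box a b : set T).
Proof.
have -> : box a b = \bigcap_(i : 'I_N)
    ([set x | (x 0 i <= b 0 i)] `&` ~` [set x | (x 0 i < a 0 i)]).
  apply/seteqP; split=> [x ab i _|x ab i] /=.
    by have /andP[? ?] := ab i; split => //; apply/negP; rewrite -leNgt.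
  by have [-> /negP] := ab i Logic.I; rewrite -leNgt => ->.
apply: fin_bigcap_measurable; first exact: finite_finset.
move=> i _; have hs h (S : set T) : (forall x, S x -> (x 0 i <= h)) ->
  (forall x, ~ S x -> (h <= x 0 i)) -> measurable S := @halfspace_caratheodory i h S.
apply: measurableI; last apply: measurableC.
  by apply: (hs (b 0 i)) => //= x /negP; rewrite -ltNge => /ltW.
by apply: (hs (a 0 i)) => //= x; [move/ltW|move/negP; rewrite -leNgt].
Qed.

Lemma open_lebesgue_measurable (U : set 'rV[R]_N) : open U -> measurable (U : set T).
Proof.
move=> oU.
(* Boxes with rational corners that stick out of [U] are replaced by the empty set, so that the
   union runs over a whole countable type. *)
pose B (p : 'rV[rat]_N * 'rV[rat]_N) : set 'rV[R]_N :=
  let C := box (map_mx ratr p.1) (map_mx ratr p.2) in if `[< C `<=` U >] then C else set0.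
have -> : U = \bigcup_p B p.
  apply/seteqP; split=> [x Ux|x [p _]]; last by rewrite /B; case: asboolP => // + ?; exact.
  have /nbhs_ballP[e /= e0 xeU] : nbhs x U by exact: open_nbhs_nbhs.
  have /choice[f fP] i : exists p : rat * rat,
      [/\ (x 0 i - e < ratr p.1), (ratr p.1 < x 0 i),
          (x 0 i < ratr p.2) & (ratr p.2 < x 0 i + e)].
    have [|p] := @rat_in_itvoo R (x 0 i - e) (x 0 i); first by rewrite ltrBlDr ltrDl.
    have [|q] := @rat_in_itvoo R (x 0 i) (x 0 i + e); first by rewrite ltrDl.
    by rewrite !in_itv/= => /andP[? ?] /andP[? ?]; exists (p, q).
  exists (\row_i (f i).1, \row_i (f i).2) => //; rewrite /B asboolT/=.
    by move=> i; rewrite !mxE; have [_ /ltW -> /ltW -> _] := fP i.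
  move=> y yf; apply: xeU; split => // k i; rewrite (ord1 k) /ball/=.
  move: (yf i) (fP i); rewrite !mxE => /andP[? ?] [? ? ? ?].
  by rewrite ltr_norml; lra.
apply: countable_bigcupT_measurable; first exact: countableP.
by move=> p; rewrite /B; case: ifP => // _; exact: measurable_box.
Qed.

Lemma continuous_lebesgue_measurable (f : 'rV[R]_N -> R) (D : set T) :
  continuous f -> measurable D -> measurable_fun D (f : T -> R).
Proof.
move=> cf mD; apply: (measurability _ (measurable_realfun.RGenOpens.measurableE R)).
move=> _ [_ [a [b ->]] <-]; apply: measurableI => //.
apply: open_lebesgue_measurable; apply: open_comp => // x _; exact: cf.
Qed.

End lebesgue_measurable.

Section lebesgue_boxes.
Context (R : realType) (N : nat).
Hypothesis N_gt0 : (0 < N)%N.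
Implicit Types (A : set 'rV[R]_N) (a b v : 'rV[R]_N).
Local Notation mu := (@lebesgue_outer R N).
Local Notation T := (caratheodory_type mu).
Local Notation leb := (lebesgueN R N).

Let le_shift A v : (mu ((fun x => x + v)%R @^-1` A) <= mu A)%E.
Proof.
rewrite leNgt; apply/negP => /(lebesgue_outer_lt N_gt0)[a [b [ab Aab]]].
rewrite ltNge => /negP; apply.
apply: le_trans (@lebesgue_outer_le _ _ _ (fun k => a k - v) (fun k => b k - v) _ _) _.
- by move=> k i; rewrite !mxE lerD2r.
- move=> x /= /Aab[k _ xk]; exists k => // i.
  by have := xk i; rewrite !mxE lerBlDr lerBrDr.
- apply: lee_nneseries => [k _ _|k _]; rewrite lee_fin.
    by rewrite prodr_ge0// => i _; rewrite !mxE subr_ge0 lerD2r.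
  rewrite [leRHS](eq_bigr (fun i => (b k - v) 0 i - (a k - v) 0 i))// => i _.
  by rewrite !mxE; ring.
Qed.

Lemma lebesgue_outer_shift A v : mu ((fun x => x + v) @^-1` A) = mu A.
Proof.
apply/eqP; rewrite eq_le le_shift/=.
apply: le_trans (le_shift _ (- v)); rewrite (_ : _ @^-1` (_ @^-1` A) = A)//.
by apply/seteqP; split => x /=; rewrite subrK.
Qed.

(** Measurability is the Caratheodory condition, which mentions only the outer measure; translation
    invariance carries it over from [B] to its preimage. *)
Lemma measurable_shift v : measurable_fun setT ((fun x => x + v) : T -> T).
Proof.
move=> _ B mB; rewrite setTI.
suff : mu.-caratheodory ((fun x : 'rV[R]_N => x + v) @^-1` B) by [].
move=> X; change (mu X = (mu (X `&` (fun x => x + v)%R @^-1` B) +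
                mu (X `&` ~` ((fun x => x + v)%R @^-1` B)))%E).
have shift Y : mu Y = mu ((fun x => x - v) @^-1` Y).
  by rewrite lebesgue_outer_shift.
rewrite shift [X in (X + _)%E]shift [X in (_ + X)%E]shift.
rewrite !preimage_setI.
have K Y : (fun x => x - v) @^-1` ((fun x => x + v) @^-1` Y) = Y.
  by apply/seteqP; split => x /=; rewrite subrK.
by rewrite -preimage_setC !K; exact: mB.
Qed.

Lemma integral_shift v (f : 'rV[R]_N -> \bar R) :
  measurable_fun setT (f : T -> \bar R) ->
  leb.-integrable setT (fun x => f (x + v)%R) ->
  (\int[leb]_x f (x + v)%R = \int[leb]_x f x)%E.
Proof.
move=> mf intf.
have E := integral_pushforward (measurable_shift v) mf intf measurableT.
refine (etrans (esym E) _).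
refine (@eq_measure_integral _ _ _ setT leb _ f _) => A _ _.
exact: lebesgue_outer_shift.
Unshelve. exact: measurable_shift.
Qed.

Lemma lebesgue_box_lty a b : (leb (box a b) < +oo)%E.
Proof.
have [ab|] := pselect (forall i, a 0 i <= b 0 i); last first.
  move=> /existsNP[i abi]; rewrite (_ : box a b = set0) ?measure0//.
  by apply/seteqP; split => // x /(_ i) /andP[ax xb]; apply: abi; exact: le_trans xb.
(* Covers are infinite sequences: the box itself is followed by one-point boxes of volume 0. *)
pose seq0 c k : 'rV[R]_N := if k is 0%N then c else 0.
have seq0_le k i : seq0 a k 0 i <= seq0 b k 0 i by case: k => //=; rewrite !mxE.
have box_cover : box a b `<=` \bigcup_k box (seq0 a k) (seq0 b k) by move=> x xab; exists 0%N.
apply: le_lt_trans (lebesgue_outer_le seq0_le box_cover) _.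
rewrite nneseries_recl//; last first.
  by move=> k _; rewrite lee_fin prodr_ge0// => i _; rewrite subr_ge0.
rewrite eseries0 ?adde0 ?ltry// => -[//|k] _ _ /=.
by case: N N_gt0 => // n _; rewrite big_ord_recl/= subrr mul0r.
Qed.

(** The nontrivial half of the volume formula: no cover is cheaper than the box. It serves to show
    that balls have positive measure. *)
Lemma lebesgue_box_ge a b : (forall i, a 0 i <= b 0 i) ->
  ((\prod_(i < N) (b 0 i - a 0 i))%:E <= leb (box a b))%E.
Proof.
move=> ab; rewrite leNgt; apply/negP => /(lebesgue_outer_lt N_gt0)[c [d [cd abcd]]].
rewrite ltNge => /negP; apply.
pose F m k (x : 'rV[R]_N) (i : 'I_N) : R :=
  if (i < m)%N then \1_`[c k 0 i, d k 0 i]%classic (x 0 i) else d k 0 i - c k 0 i.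
have F_ge0 m k x i : 0 <= F m k x i.
  by rewrite /F; case: ifP => // _; rewrite subr_ge0.
pose L m (i : 'I_N) : R := if (i < m)%N then 1 else b 0 i - a 0 i.
(* Fubini one variable at a time: the coordinates of index at least [m] have
   been integrated out, using only Lebesgue measure on the line. *)
suff main m : (m <= N)%N -> forall x, box a b x ->
    ((\prod_i L m i)%:E <= \sum_(k <oo) (\prod_i F m k x i)%:E)%E.
  by apply: (main 0%N _ a) => // i; rewrite lexx ab.
(* Downward induction on [m]. At [m = N] the claim is that some box of the cover contains [x], so
   that some term is 1; at [m = 0] no variable is left and the claim compares volumes. *)
move=> /subKn <-; elim: (N - m)%N (leq_subr m N) => [|j IHj] jN x xab.
  rewrite subn0; have [k _ xk] := abcd _ xab.
  rewrite (nneseriesD1 (n := k))//; last first.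
    by move=> l _; rewrite lee_fin prodr_ge0.
  rewrite -[leLHS]adde0; apply: leeD; last first.
    by apply: nneseries_ge0 => l _ _; rewrite lee_fin prodr_ge0.
  rewrite lee_fin ler_prod// => i _; rewrite /L /F ltn_ord ler01/=.
  by rewrite indicE mem_set//= in_itv/=; exact: xk.
have iN : (N - j.+1 < N)%N by rewrite -subSn// subSS leq_subr.
pose i := Ordinal iN.
have ji : (N - j = i.+1)%N by rewrite /= subnSK.
have FL (G : nat -> 'I_N -> R) (l : 'I_N) : l != i -> (l < N - j.+1)%N = (l < N - j)%N.
  by rewrite ji ltnS [RHS]leq_eqVlt /= => /negPf; rewrite -val_eqE/= => ->.
rewrite (bigD1 i)//= {1}/L /= ltnn.
pose I := `[a 0 i, b 0 i]%classic.
pose rest := \prod_(l < N | l != i) L (N - j)%N l.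
pose restF k := \prod_(l < N | l != i) F (N - j)%N k x l.
have -> : \prod_(l < N | l != i) L (N - j.+1)%N l = rest.
  by apply: eq_bigr => l li; rewrite /L (FL (fun=> fun=> 0)).
have mI (x1 y1 : R) : measurable (`[x1, y1]%classic : set R) := measurable_itv _.
have Iint (k : nat) : (\int[lebesgue_measure]_(t in I)
    (\1_`[c k 0 i, d k 0 i]%classic t)%:E <= (d k 0 i - c k 0 i)%:E)%E.
  rewrite /I integral_indic//.
  apply: le_trans (le_measure lebesgue_measure _ _ (@subIsetl _ _ _)) _; rewrite ?inE//.
    by apply: measurableI; exact: mI.
  by rewrite /= lebesgue_measure_itv/= lte_fin; case: ifP; rewrite // lee_fin subr_ge0.
apply: (@le_trans _ _ (\int[lebesgue_measure]_(t in I) (cst rest%:E t))%E).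
  rewrite /I integral_cst//= lebesgue_measure_itv/= lte_fin.
  case: ltP => // ba; first by rewrite mulrC EFinM -EFinB.
  by rewrite (le_anti (introT andP (conj (ab i) ba))) subrr mul0r mule0.
have restF0 k : 0 <= restF k by rewrite prodr_ge0.
apply: (@le_trans _ _ (\int[lebesgue_measure]_(t in I)
    \sum_(k <oo) ((restF k)%:E * (\1_`[c k 0 i, d k 0 i]%classic t)%:E))%E).
  apply: ge0_le_integral => //; rewrite /I//.
  - by move=> t _; rewrite lee_fin prodr_ge0// => l _; rewrite /L; case: ifP; rewrite // subr_ge0.
  - apply: ge0_emeasurable_sum => [k t _ _|k _]; first by rewrite mule_ge0// lee_fin.
    by apply: measurable_funeM; exact/measurable_EFinP.
  - move=> t; rewrite /= in_itv/= => tab.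
    pose y : 'rV[R]_N := \row_l if l == i then t else x 0 l.
    have yab : box a b y by move=> l; rewrite mxE; case: eqP => [->|].
    apply: le_trans (le_trans (IHj (ltnW jN) y yab) _).
      rewrite (bigD1 i)//= {1}/L ji leqnn mul1r.
      by rewrite /cst /rest ji.
    rewrite le_eqVlt; apply/orP; left; apply/eqP; apply: eq_eseriesr => k _.
    rewrite (bigD1 i)//= EFinM muleC; congr (_%:E * _%:E)%E.
      apply: eq_bigr => l li; rewrite /F; case: ifP => // _.
      by rewrite mxE (negPf li).
    by rewrite /F ji leqnn mxE eqxx.
rewrite /I integral_nneseries//; last 2 first.
- by move=> k; apply: measurable_funeM; exact/measurable_EFinP.
- by move=> k t _; rewrite mule_ge0// lee_fin.
apply: lee_nneseries => [k _ _|k _].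
  by apply: integral_ge0 => t _; rewrite mule_ge0// lee_fin.
rewrite ge0_integralZl_EFin//; last exact/measurable_EFinP.
rewrite (bigD1 i)//= {1}/F ltnn mulrC EFinM.
rewrite (_ : \prod_(l < N | l != i) _ = restF k); last first.
  by apply: eq_bigr => l li; rewrite /F (FL (fun=> fun=> 0)).
by rewrite lee_pmul// ?lee_fin//; apply: integral_ge0 => t _; rewrite lee_fin.
Qed.

End lebesgue_boxes.

(** * Integration by parts *)

Lemma continuous_add (R : realType) (T : topologicalType) (f g : T -> R) :
  continuous f -> continuous g -> continuous (fun x => f x + g x).
Proof. by move=> cf cg x; apply: (@cvgD _ _ _ (nbhs x) _ f g); [exact: cf|exact: cg]. Qed.

Lemma continuous_mul (R : realType) (T : topologicalType) (f g : T -> R) :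
  continuous f -> continuous g -> continuous (fun x => f x * g x).
Proof. by move=> cf cg x; apply: (@cvgM _ _ (nbhs x) _ f g); [exact: cf|exact: cg]. Qed.

Lemma continuous_sum (R : realType) (T : topologicalType) (n : nat) (f : 'I_n -> T -> R) :
  (forall i, continuous (f i)) -> continuous (fun x => \sum_(i < n) f i x).
Proof.
move=> cf; elim: (index_enum _) => [|i s IH].
  rewrite (_ : (fun x => _) = cst 0); first exact: cst_continuous.
  by apply/funext => x; rewrite big_nil.
rewrite (_ : (fun x => _) = fun x => f i x + \sum_(k <- s) f k x).
  exact: continuous_add.
by apply/funext => x; rewrite big_cons.
Qed.

Lemma continuous_opp (R : realType) (T : topologicalType) (f : T -> R) :
  continuous f -> continuous (fun x => - f x).
Proof. by move=> cf x; apply: (@cvgN _ _ _ (nbhs x) _ f); exact: cf. Qed.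

Section bounded_support.
Context (R : realType) (N : nat).
Hypothesis N_gt0 : (0 < N)%N.
Local Notation T := (caratheodory_type (@lebesgue_outer R N)).
Local Notation leb := (lebesgueN R N).
Implicit Types (K : set 'rV[R]_N) (f g : 'rV[R]_N -> R) (M C : R).

Definition cube M : set 'rV[R]_N := box (const_mx (- M)) (const_mx M).

Lemma cubeP M x : cube M x <-> forall i, `|x 0 i| <= M.
Proof. by split=> xM i; have := xM i; rewrite !mxE ler_norml. Qed.

Lemma compact_sub_cube K : compact K -> exists2 M, 0 < M & K `<=` cube M.
Proof.
move=> /compact_bounded[M [_ KM]]; exists (`|M| + 1); first by rewrite ltr_pwDr.
move=> x Kx; apply/cubeP => i.
have : `|x| <= `|M| + 1.
  by apply: KM => //; rewrite (le_lt_trans (ler_norm M))// ltrDl.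
apply: le_trans; rewrite [leRHS]/Num.norm/= mx_normrE.
exact: (le_bigmax _ (fun ij : 'I_1 * 'I_N => `|x ij.1 ij.2|) (0, i)).
Qed.

Lemma cube_integrable f M C : measurable_fun setT (f : T -> R) ->
  (forall x, `|f x| <= C) -> (forall x, ~ cube M x -> f x = 0) ->
  leb.-integrable setT (EFin \o f).
Proof.
move=> mf fC fM.
have -> : EFin \o f = (EFin \o f) \_ (cube M).
  apply/funext => x; rewrite patchE; case: ifPn => //.
  by move=> /negP; rewrite inE /= => /fM ->.
rewrite -integrable_mkcond; last exact: measurable_box.
apply: measurable_bounded_integrable.
- exact: measurable_box.
- exact: lebesgue_box_lty.
- exact: measurable_funS mf.
- exists C; split; first exact: num_real.
  by move=> C' CC' x _; exact: le_trans (fC x) (ltW CC').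
Qed.

(** Dominated convergence with [C] times the indicator of a cube as the dominating function; the
    pointwise limit inherits the bound and the support. All passages to the limit under an integral
    below go through this form. *)
Lemma cube_cvg_Rintegral (f_ : nat -> 'rV[R]_N -> R) f M C :
  (forall n, measurable_fun setT (f_ n : T -> R)) ->
  (forall n x, `|f_ n x| <= C) -> (forall n x, ~ cube M x -> f_ n x = 0) ->
  (forall x, f_ ^~ x @ \oo --> f x) ->
  leb.-integrable setT (EFin \o f) /\
  (fun n => Rintegral leb setT (f_ n)) @ \oo --> Rintegral leb setT f.
Proof.
move=> mf fC fM cf.
have mF : measurable_fun setT (f : T -> R).
  by apply: (@measurable_fun_cvg _ T R setT f_ f) => // x _; exact: cf.
have M_ext x : ~ cube M x -> f x = 0.
  move=> Mx; apply: (cvg_unique (@norm_hausdorff _ _) (cf x)) => //.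
  by rewrite (_ : f_ ^~ x = cst 0); [exact: cvg_cst|apply/funext => n; exact: fM].
have C_ge x : `|f x| <= C.
  apply: (@closed_cvg _ _ \oo _ (fun n => `|f_ n x|) (fun y => y <= C)).
  - exact: closed_le.
  - by apply: nearW => n; exact: fC.
  - exact: cvg_norm.
have intf := cube_integrable mF C_ge M_ext.
split => //.
pose g (x : 'rV[R]_N) : R := C * \1_(cube M) x.
have intg : leb.-integrable setT (EFin \o g).
  apply: (@cube_integrable g M `|C|).
  - by apply: measurable_funM => //; apply: measurable_indic; exact: measurable_box.
  - move=> x; rewrite normrM indicE; case: (_ \in _); rewrite ?normr1 ?mulr1//.
    by rewrite normr0 mulr0.
  - by move=> x Mx; rewrite /g indicE memNset// mulr0.
have [||||_ _ cvgI] := @dominated_convergence _ _ _ leb setT measurableT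
  (fun n => EFin \o f_ n) (EFin \o f) (EFin \o g) _ _ _ intg _.
- by move=> n; apply/measurable_EFinP; exact: mf.
- exact/measurable_EFinP.
- by apply: aeW => x _; apply: cvg_EFin; [exact: nearW|exact: cf].
- apply: aeW => x n _; rewrite lee_fin /g indicE; have [xM|xM] := boolP (x \in cube M).
    by rewrite mulr1 fC.
  by rewrite mulr0 fM ?normr0//; move: xM; rewrite notin_setE.
apply: fine_cvg; rewrite /Rintegral fineK; first exact: cvgI.
exact: integrable_fin_num.
Qed.

Lemma continuous_support_bounded K f : compact K -> continuous f ->
  (forall x, ~ K x -> f x = 0) -> exists2 C, 0 <= C & forall x, `|f x| <= C.
Proof.
move=> cK cf Kf.
have /compact_bounded[M [_ HM]] := continuous_compact (continuous_subspaceT cf) cK.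
exists (`|M| + 1); first by rewrite addr_ge0.
move=> x; have [Kx|/Kf ->] := pselect (K x); last by rewrite normr0 addr_ge0.
apply: (HM (`|M| + 1)); last by exists x.
by rewrite (le_lt_trans (ler_norm M))// ltrDl.
Qed.

Lemma partial_support K f i : compact K -> (forall x, ~ K x -> f x = 0) ->
  forall x, ~ K x -> partial i f x = 0.
Proof.
move=> cK Kf x Kx.
have oK : open (~` K) by apply: closed_openC; apply: compact_closed => //; exact: norm_hausdorff.
rewrite /partial -(derive_cst (0 : R) x (delta_mx 0 i)).
apply: near_eq_derive; near=> y; apply: Kf.
by near: y; exact: open_nbhs_nbhs.
Unshelve. all: by end_near. Qed.

(** The two difference quotients are the same function of the increment. This gives access to
    one-variable calculus along lines: the mean value theorem and the chain rule. *)
Lemma is_derive_line f (v x : 'rV[R]_N) (t d : R) :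
  is_derive (t *: v + x) v f d <-> is_derive t 1 (fun s : R => f (s *: v + x)) d.
Proof.
set F := fun s : R => f (s *: v + x).
have E : (fun h : R => h^-1 *: ((f \o shift (t *: v + x)) (h *: v) - f (t *: v + x))) =
         (fun h : R => h^-1 *: ((F \o shift t) (h *: (1 : R)) - F t)).
  by apply/funext => h; rewrite /F /= scalerDl addrA [_%:A]mulr1.
by split=> -[df <-]; split; rewrite /derivable /derive ?E// -E.
Qed.

Lemma partial_mean_value f i (x : 'rV[R]_N) (h : R) : 0 < h ->
  (forall y, derivable f y (delta_mx 0 i)) ->
  exists c, f (h *: delta_mx 0 i + x) - f x = h * partial i f (c *: delta_mx 0 i + x).
Proof.
move=> h0 df; set v := delta_mx 0 i.
have dF (t : R) : is_derive t 1 (fun s : R => f (s *: v + x)) (partial i f (t *: v + x)).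
  by apply/is_derive_line; exact: derivableP.
have [|c _] := @MVT R (fun s : R => f (s *: v + x)) (fun t => partial i f (t *: v + x)) 0 h h0 (fun t _ => dF t) _.
- apply: continuous_subspaceT => t; apply: differentiable_continuous.
  by apply/derivable1_diffP; have [] := dF t.
- by rewrite scale0r add0r subr0 mulrC => fE; exists c.
Qed.

(** Dominated convergence is about sequences, so the derivative has to be read along a sequence of
    nonzero increments. *)
Lemma cvg_harmonic_dnbhs : (@harmonic R) @ \oo --> (0 : R)^'.
Proof.
move=> A [e /= e0 eA]; suff : \forall n \near \oo, A (harmonic n) by [].
near=> n; apply: eA.
  by near: n; exact: (cvg_harmonic (nbhsx_ballx _ _ e0)).
by rewrite gt_eqF//; exact: harmonic_gt0.
Unshelve. all: by end_near. Qed.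

Lemma cvg_difference_quotient f (v x : 'rV[R]_N) : derivable f x v ->
  (fun n => (harmonic n)^-1 * (f (harmonic n *: v + x) - f x)) @ \oo --> 'D_v f x.
Proof. by move=> df; exact: (cvg_comp _ _ cvg_harmonic_dnbhs df). Qed.

(* By translation invariance the difference quotients of [f] have zero integral. *)
Lemma Rintegral_partial0 K f i : compact K -> continuous f ->
  (forall x, ~ K x -> f x = 0) -> (forall x, derivable f x (delta_mx 0 i)) ->
  continuous (partial i f) -> Rintegral leb setT (partial i f) = 0.
Proof.
move=> cK cf Kf df cdf; pose v : 'rV[R]_N := delta_mx 0 i.
have [M M0 KM] := compact_sub_cube cK.
(* A bound for the partial derivative is, by the mean value theorem, a bound for all the difference
   quotients. *)
have [C C0 dfC] := continuous_support_bounded cK cdf (partial_support i cK Kf).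
have [C' C'0 fC'] := continuous_support_bounded cK cf Kf.
have cfv (h : R) : continuous (fun x => f (h *: v + x)).
  have cs : continuous (fun x : 'rV[R]_N => h *: v + x).
    by move=> x; apply: (@cvgD _ _ _ (nbhs x) _ (fun=> h *: v) id); [exact: cvg_cst|exact: cvg_id].
  by move=> x; exact: (continuous_comp (cs x) (cf _)).
pose q n x := (harmonic n)^-1 * (f (harmonic n *: v + x) - f x).
(* The increments [harmonic n] are at most 1, so the cube enlarged by 1 contains the supports of all
   the translates. *)
have M1f x : ~ cube (M + 1) x -> f x = 0.
  move=> xM; apply: Kf => /KM /cubeP xM'; apply: xM; apply/cubeP => j.
  by rewrite (le_trans (xM' j))// lerDl.
have M1fv n x : ~ cube (M + 1) x -> f (harmonic n *: v + x) = 0.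
  move=> xM; apply: Kf => /KM /cubeP xM'; apply: xM; apply/cubeP => j.
  have := xM' j; rewrite !mxE; set e : R := harmonic n * _; move=> xe.
  have e1 : `|e| <= 1.
    rewrite /e normrM; apply: mulr_ile1 => //.
      by rewrite ger0_norm ?harmonic_ge0// /harmonic invf_le1// ler1n.
    by rewrite eqxx; case: eqP; rewrite ?normr1 ?normr0.
  rewrite (_ : x 0 j = (e + x 0 j) - e); last by ring.
  by rewrite (le_trans (ler_normB _ _))// lerD.
have intf : leb.-integrable setT (EFin \o f).
  by apply: cube_integrable fC' M1f; exact: continuous_lebesgue_measurable.
pose fv n (x : 'rV[R]_N) : R := f (harmonic n *: v + x).
have intfv n : leb.-integrable setT (EFin \o fv n).
  apply: (@cube_integrable (fv n) (M + 1) C') => [|x|x]; last exact: M1fv.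
    by apply: continuous_lebesgue_measurable => //; exact: cfv.
  exact: fC'.
have fvE n : Rintegral leb setT (fv n) = Rintegral leb setT f.
  rewrite /Rintegral; congr fine.
  rewrite -(@integral_shift R N N_gt0 (harmonic n *: v) (EFin \o f)).
  - by apply: eq_integral => x _ /=; rewrite addrC.
  - by apply/measurable_EFinP; exact: continuous_lebesgue_measurable.
  - by apply: eq_integrable (intfv n) => // x _ /=; rewrite addrC.
have q0 n : Rintegral leb setT (q n) = 0.
  have intB := integrableB measurableT (intfv n) intf.
  transitivity ((harmonic n)^-1 * Rintegral leb setT (fun x => fv n x - f x)).
    exact: RintegralZl.
  by rewrite RintegralB// fvE subrr mulr0.
have [||||_] := @cube_cvg_Rintegral q (partial i f) (M + 1) C.
- move=> n; apply: continuous_lebesgue_measurable => //.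
  apply: continuous_mul; first exact: cst_continuous.
  apply: continuous_add; first exact: cfv.
  exact: continuous_opp.
- move=> n x; rewrite /q.
  have [c E] := partial_mean_value x (harmonic_gt0 n) df.
  by rewrite [X in _ * X]E mulKf// gt_eqF// harmonic_gt0.
- by move=> n x xM; rewrite /q M1fv// M1f// subrr mulr0.
- by move=> x; exact: cvg_difference_quotient.
move=> /(cvg_unique (@norm_hausdorff _ _)); apply.
by rewrite (_ : (fun n => _) = cst 0); [exact: cvg_cst|apply/funext => n; exact: q0].
Qed.

(** The product has compact support as soon as [g] does, so its partial derivative integrates to 0.
    [f] may be unbounded, like the coordinate functions used later. *)
Lemma Rintegral_by_parts K f g i : compact K ->
  continuous f -> continuous g -> (forall x, ~ K x -> g x = 0) ->
  (forall x, derivable f x (delta_mx 0 i)) -> (forall x, derivable g x (delta_mx 0 i)) ->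
  continuous (partial i f) -> continuous (partial i g) ->
  Rintegral leb setT (fun x => f x * partial i g x) =
  - Rintegral leb setT (fun x => partial i f x * g x).
Proof.
move=> cK cf cg Kg df dg cdf cdg.
have pfg : partial i (fun x => f x * g x) = (fun x => f x * partial i g x + partial i f x * g x).
  apply/funext => x; rewrite /partial.
  rewrite (_ : (fun x => f x * g x) = f * g)// deriveM// addrC.
  by rewrite addrC /GRing.scale/= [X in _ + X]mulrC.
have [M M0 KM] := compact_sub_cube cK.
have cont1 : continuous (fun x => f x * partial i g x).
  exact: continuous_mul.
have cont2 : continuous (fun x => partial i f x * g x).
  exact: continuous_mul.
have supp1 x : ~ K x -> f x * partial i g x = 0.
  by move=> Kx; rewrite (partial_support i cK Kg)// mulr0.
have supp2 x : ~ K x -> partial i f x * g x = 0 by move=> Kx; rewrite Kg// mulr0.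
have int h : continuous h -> (forall x, ~ K x -> h x = 0) -> leb.-integrable setT (EFin \o h).
  move=> ch Kh; have [C _ hC] := continuous_support_bounded cK ch Kh.
  apply: (@cube_integrable h M C) => //; first exact: continuous_lebesgue_measurable.
  by move=> x xM; apply: Kh => /KM.
apply/eqP; rewrite -addr_eq0 -RintegralD//; [|exact: int..].
rewrite -pfg (Rintegral_partial0 cK)//.
- exact: continuous_mul.
- by move=> x Kx; rewrite Kg// mulr0.
- by move=> x; exact: derivableM.
- by rewrite pfg; exact: continuous_add.
Qed.

End bounded_support.

(** * Cutoffs and radial functions *)

Section one_variable.
Context (R : realType).
Implicit Types (G dG : R -> R).

Definition C1 G dG := (forall u : R, is_derive u 1 G (dG u)) /\ continuous dG.

Lemma C1_continuous G dG : C1 G dG -> continuous G.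
Proof.
move=> [Gd _] u; apply: differentiable_continuous.
by apply/derivable1_diffP; have [] := Gd u.
Qed.

Lemma continuous_comp_fun (T U V : topologicalType) (f : T -> U) (g : U -> V) :
  continuous f -> continuous g -> continuous (fun x => g (f x)).
Proof. by move=> cf cg x; exact: (continuous_comp (cf x) (cg _)). Qed.

Lemma C1_comp G dG H dH : C1 G dG -> C1 H dH ->
  C1 (fun u => G (H u)) (fun u => dG (H u) * dH u).
Proof.
move=> G1 H1; split=> [u|].
  have h1 := G1.1 (H u); have h2 := H1.1 u.
  exact: (is_derive1_comp h1 h2).
apply: continuous_mul; last exact: H1.2.
by apply: continuous_comp_fun G1.2; exact: C1_continuous H1.
Qed.

Lemma C1_affine (a b : R) : C1 (fun u => a * u + b) (fun=> a).
Proof.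
split; last exact: cst_continuous.
by move=> u; apply: is_derive_eq; rewrite addr0 [_%:A]mulr1.
Qed.

(** The building block of all the cutoffs: it vanishes on a half-line and is C^1, so that
    compositions need no gluing of derivatives. *)
Definition sqpos (u : R) : R := Num.max u 0 ^+ 2.

Lemma continuous_pos : continuous (fun u : R => Num.max u 0).
Proof.
move=> u; apply: (@continuous_max R R id (cst 0)); first exact: cvg_id.
exact: cvg_cst.
Qed.

Lemma C1_sqpos : C1 sqpos (fun u => 2 * Num.max u 0).
Proof.
split; last first.
  by apply: continuous_mul; [exact: cst_continuous|exact: continuous_pos].
move=> u; set d := 2 * _.
(* A quadratic remainder, uniform in [u], also covers the kink of the positive part at 0. *)
have key (h : R) : `|sqpos (h + u) - sqpos u - d * h| <= h ^+ 2.
  rewrite /sqpos /d ler_norml; case: (leP (h + u) 0) => ?; case: (leP u 0) => ?;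
    apply/andP; split; nra.
have cvgd : (fun h : R => h^-1 *: ((sqpos \o shift u) (h *: (1 : R)) - sqpos u)) @ 0^' --> d.
  apply/cvgrPdist_le => e e0; near=> h.
  have h0 : h != 0 by near: h; exact: nbhs_dnbhs_neq.
  rewrite /= [_%:A]mulr1 [_ *: _]mulrC distrC.
  have -> : (sqpos (h + u) - sqpos u) * h^-1 - d = (sqpos (h + u) - sqpos u - d * h) / h.
    by field.
  rewrite normrM normfV ler_pdivrMr ?normr_gt0//.
  apply: le_trans (key h) _; rewrite -real_normK ?num_real// expr2 ler_wpM2r//.
  near: h; apply: dnbhs0_le => //.
split; first by apply/cvg_ex; exists d.
exact: cvg_lim cvgd.
Unshelve. all: by end_near. Qed.

(** A C^1 transition from 0 for u <= 0 to 1 for u >= 1; the inner square smooths the corner at 0 and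
    the outer one the corner at 1. *)
Definition step (u : R) : R := 1 - sqpos (1 - sqpos u).
Definition dstep (u : R) : R := 4 * Num.max (1 - sqpos u) 0 * Num.max u 0.

Lemma C1_step : C1 step dstep.
Proof.
have C1' : C1 (fun u : R => -1 * u + 1) (fun=> -1) := C1_affine _ _.
have := C1_comp C1' (C1_comp C1_sqpos (C1_comp C1' C1_sqpos)).
have E (v : R) : -1 * v + 1 = 1 - v by ring.
congr C1; apply/funext => u; rewrite /step /dstep /= !E//.
by ring.
Qed.

Lemma step_ge1 u : 1 <= u -> step u = 1 /\ dstep u = 0.
Proof.
move=> u1; have u0 : 0 <= u by lra.
have su : sqpos u = u ^+ 2 by rewrite /sqpos max_l.
have s1 : Num.max (1 - u ^+ 2) 0 = 0 by apply: max_r; nra.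
by rewrite /step /dstep su /sqpos s1; split; ring.
Qed.

Lemma step_le0 u : u <= 0 -> step u = 0 /\ dstep u = 0.
Proof.
move=> u0; have su : sqpos u = 0 by rewrite /sqpos max_r// expr0n.
rewrite /step /dstep su (max_r u0) /sqpos max_l ?subr0//.
by split; ring.
Qed.

Lemma step_bounds u : 0 <= step u <= 1.
Proof.
rewrite /step; have : 0 <= sqpos (1 - sqpos u) by exact: sqr_ge0.
have s0 : 0 <= sqpos u by exact: sqr_ge0.
have : sqpos (1 - sqpos u) <= 1.
  by rewrite /sqpos; case: (leP (1 - Num.max u 0 ^+ 2) 0) => [_|h]; rewrite ?expr0n//=;
    move: s0; rewrite /sqpos => s0; nra.
lra.
Qed.

Lemma dstep_ge0 u : 0 <= dstep u.
Proof. by rewrite /dstep !mulr_ge0// le_max lexx orbT. Qed.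

End one_variable.

Section several_variables.
Context (R : realType) (N : nat).
Hypothesis N_gt0 : (0 < N)%N.
Local Notation T := (caratheodory_type (@lebesgue_outer R N)).
Local Notation leb := (lebesgueN R N).
Implicit Types (K : set 'rV[R]_N) (f g df dg : 'rV[R]_N -> R) (a x : 'rV[R]_N) (i j : 'I_N).

Definition has_partial i f df :=
  [/\ continuous f, continuous df & forall x, is_derive x (delta_mx 0 i) f (df x)].

Lemma has_partialE i f df : has_partial i f df -> partial i f = df.
Proof. by move=> [_ _ fdf]; apply/funext => x; exact: derive_val. Qed.

Lemma Ck_has_partial f i : Ck 1 f -> has_partial i f (partial i f).
Proof.
by move=> [cf /(_ i)[df [cdf _]]]; split => // x; exact: derivableP.
Qed.

Lemma has_partial_Ck f : (forall i, exists df, has_partial i f df) ->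
  continuous f -> Ck 1 f.
Proof.
move=> fdf cf; split => // i; have [df fi] := fdf i.
split; first by case: fi => _ _ dfx x; have [] := dfx x.
by rewrite (has_partialE fi); case: fi.
Qed.

Lemma has_partial_mul i f df g dg : has_partial i f df -> has_partial i g dg ->
  has_partial i (fun x => f x * g x) (fun x => df x * g x + f x * dg x).
Proof.
move=> [cf cdf fdf] [cg cdg gdg]; split; first exact: continuous_mul.
  by apply: continuous_add; exact: continuous_mul.
move=> x; have := is_deriveM (fdf x) (gdg x).
by rewrite addrC /GRing.scale/= [g x * _]mulrC.
Qed.

Lemma has_partial_comp i f df (G dG : R -> R) : has_partial i f df -> C1 G dG ->
  has_partial i (fun x => G (f x)) (fun x => dG (f x) * df x).
Proof.
move=> [cf cdf fdf] G1; split.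
- by apply: continuous_comp_fun => //; exact: C1_continuous G1.
- by apply: continuous_mul => //; apply: continuous_comp_fun => //; exact: G1.2.
move=> x; pose v : 'rV[R]_N := delta_mx 0 i.
have xE : x = (0 : R) *: v + x by rewrite scale0r add0r.
have := fdf x; rewrite {1}xE => /is_derive_line fv.
have Gfx : is_derive (f ((0 : R) *: v + x)) 1 G (dG (f x)).
  by rewrite -xE; exact: G1.1.
by rewrite {1}xE; apply/is_derive_line; exact: (is_derive1_comp Gfx fv).
Qed.

Lemma has_partial_coord a i j :
  has_partial i (fun x => x 0 j - a 0 j) (fun=> (i == j)%:R).
Proof.
split; [|exact: cst_continuous|].
  apply: continuous_add; [exact: coord_continuous|exact: cst_continuous].
move=> x; pose v : 'rV[R]_N := delta_mx 0 i.
have -> : x = (0 : R) *: v + x by rewrite scale0r add0r.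
apply/is_derive_line.
have -> : (fun s : R => (s *: v + x) 0 j - a 0 j) =
          (fun s : R => (i == j)%:R * s + (x 0 j - a 0 j)).
  by apply/funext => s; rewrite !mxE eqxx /= eq_sym mulrC addrA.
exact: (C1_affine _ _).1.
Qed.

Definition sqdist a x : R := \sum_(j < N) (x 0 j - a 0 j) ^+ 2.

Lemma has_partial_sqdist a i :
  has_partial i (sqdist a) (fun x => 2 * (x 0 i - a 0 i)).
Proof.
have sqc j : has_partial i (fun x => (x 0 j - a 0 j) ^+ 2)
    (fun x => (i == j)%:R * (x 0 j - a 0 j) + (x 0 j - a 0 j) * (i == j)%:R).
  exact: has_partial_mul (has_partial_coord a i j) (has_partial_coord a i j).
have sqE : sqdist a = \sum_(j < N) (fun x => (x 0 j - a 0 j) ^+ 2).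
  by apply/funext => x; rewrite fct_sumE.
split.
- by apply: continuous_sum => j; have [] := sqc j.
- apply: continuous_mul; first exact: cst_continuous.
  by have [] := has_partial_coord a i i.
move=> x; rewrite sqE.
have -> : 2 * (x 0 i - a 0 i) =
  \sum_(j < N) ((i == j)%:R * (x 0 j - a 0 j) + (x 0 j - a 0 j) * (i == j)%:R).
  rewrite (bigD1 i)//= eqxx big1 => [|j /negPf ji]; first by rewrite mul1r mulr1; ring.
  by rewrite eq_sym ji mul0r mulr0 addr0.
by apply: is_derive_sum => j; have [] := sqc j.
Qed.

Lemma Rintegral_sum (f : 'I_N -> 'rV[R]_N -> R) :
  (forall i, leb.-integrable setT (EFin \o f i)) ->
  Rintegral leb setT (fun x => \sum_i f i x) = \sum_i Rintegral leb setT (f i).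
Proof.
move=> intf; rewrite /Rintegral.
under eq_integral do rewrite -sumEFin.
rewrite (integral_sum measurableT)// -sum_fine// => i _.
exact: (integrable_fin_num measurableT (intf i)).
Qed.

Lemma compact_integrable K f : compact K -> continuous f ->
  (forall x, ~ K x -> f x = 0) -> leb.-integrable setT (EFin \o f).
Proof.
move=> cK cf Kf; have [M _ KM] := compact_sub_cube cK.
have [C _ fC] := continuous_support_bounded cK cf Kf.
apply: (@cube_integrable _ _ _ f M C) => //; first exact: continuous_lebesgue_measurable.
by move=> x xM; apply: Kf => /KM.
Qed.

Lemma divergence_by_parts K (Z dZ dphi : 'I_N -> 'rV[R]_N -> R) phi : compact K ->
  (forall i, has_partial i (Z i) (dZ i)) -> (forall i, has_partial i phi (dphi i)) ->
  (forall x, ~ K x -> phi x = 0) ->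
  Rintegral leb setT (fun x => \sum_i Z i x * dphi i x) =
  - Rintegral leb setT (fun x => (\sum_i dZ i x) * phi x).
Proof.
move=> cK ZdZ phidphi Kphi.
have Kdphi i x : ~ K x -> dphi i x = 0.
  by move=> Kx; rewrite -(has_partialE (phidphi i)); exact: partial_support Kphi _ Kx.
under [in RHS]eq_Rintegral do rewrite mulr_suml.
have int1 i : leb.-integrable setT (EFin \o (fun x => Z i x * dphi i x)).
  apply: (compact_integrable cK); last by move=> x Kx; rewrite Kdphi ?mulr0.
  by have [cZ _ _] := ZdZ i; have [_ cdp _] := phidphi i; exact: continuous_mul.
have int2 i : leb.-integrable setT (EFin \o (fun x => dZ i x * phi x)).
  apply: (compact_integrable cK); last by move=> x Kx; rewrite Kphi ?mulr0.
  by have [_ cdZ _] := ZdZ i; have [cp _ _] := phidphi i; exact: continuous_mul.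
rewrite (Rintegral_sum int1) (Rintegral_sum int2).
rewrite -sumrN; apply: eq_bigr => i _.
have [cZ cdZ Zd] := ZdZ i; have [cp cdp pd] := phidphi i.
rewrite -(has_partialE (ZdZ i)) -(has_partialE (phidphi i)).
apply: (Rintegral_by_parts N_gt0 cK cZ cp Kphi).
- by move=> x; case: (Zd x).
- by move=> x; case: (pd x).
- by rewrite (has_partialE (ZdZ i)).
- by rewrite (has_partialE (phidphi i)).
Qed.

End several_variables.

(** * The perimeter of a ball *)

Section ball.
Context (R : realType) (N : nat).
Hypothesis N_gt0 : (0 < N)%N.
Local Notation T := (caratheodory_type (@lebesgue_outer R N)).
Local Notation leb := (lebesgueN R N).
Variable a : 'rV[R]_N.
Implicit Types (x : 'rV[R]_N) (i j : 'I_N) (r rho : R).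

(** The argument is the square of the radius. *)
Definition cball r : set 'rV[R]_N := [set x | sqdist a x <= r].

Let Na_gt0 : 0 < N%:R :> R. Proof. by rewrite ltr0n. Qed.

Lemma sqdist_ge0 x : 0 <= sqdist a x.
Proof. by apply: sumr_ge0 => j _; exact: sqr_ge0. Qed.

Lemma coord_le_sqdist x i : (x 0 i - a 0 i) ^+ 2 <= sqdist a x.
Proof. by rewrite /sqdist (bigD1 i)//= lerDl sumr_ge0// => j _; exact: sqr_ge0. Qed.

Lemma continuous_sqdist : continuous (sqdist a).
Proof. by have [] := has_partial_sqdist a (Ordinal N_gt0). Qed.

Lemma closed_cball r : closed (cball r).
Proof.
apply: (@preimage_closed _ _ (sqdist a) [set y | y <= r]); last exact: closed_le.
by move=> x _; exact: continuous_sqdist.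
Qed.

Lemma compact_cball r : compact (cball r).
Proof.
pose A i : set R := `[a 0 i - (`|r| + 1), a 0 i + (`|r| + 1)]%classic.
apply: (subclosed_compact (closed_cball (r := r)) (@rV_compact _ _ A _)) => [i|x xr i].
  exact: segment_compact.
rewrite /A /= in_itv/=; have := coord_le_sqdist x i; have := ler_norm r.
have : 0 <= `|r| by []; move: xr; rewrite /cball /=; set y := x ord0 i; set b := a 0 i.
move=> xr r0 rr yb.
by apply/andP; split; nra.
Qed.

Lemma measurable_cball r : measurable (cball r : set T).
Proof.
rewrite -[cball r]setCK; apply: measurableC; apply: open_lebesgue_measurable => //.
by apply: closed_openC; exact: closed_cball.
Qed.

Lemma lebesgue_cball_gt0 rho : 0 < rho -> (0 < leb (cball (rho ^+ 2)))%E.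
Proof.
(* Half the side of a cube inside the ball: N d^2 = rho^2 / N <= rho^2, with no square root of
   [N]. *)
move=> rho0; pose d : R := rho / N%:R.
have d0 : 0 < d by rewrite divr_gt0.
pose b : 'rV[R]_N := const_mx d.
have bE i : (a + b) 0 i - (a - b) 0 i = 2 * d by rewrite !mxE; ring.
apply: (@lt_le_trans _ _ (leb (box (a - b) (a + b)))).
  apply: lt_le_trans (lebesgue_box_ge N_gt0 _); last first.
    by move=> i; rewrite -subr_ge0 bE mulr_ge0// ltW.
  by rewrite lte_fin prodr_gt0// => i _; rewrite bE mulr_gt0.
apply: le_outer_measure => x xab; rewrite /cball /=.
apply: (@le_trans _ _ (\sum_(j < N) d ^+ 2)).
  by apply: ler_sum => j _; have /andP := xab j; rewrite !mxE => -[? ?]; nra.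
rewrite sumr_const card_ord.
have -> : d ^+ 2 *+ N = rho ^+ 2 / N%:R.
  by rewrite /d -mulr_natl; field; rewrite gt_eqF.
by rewrite ler_pdivrMr// ler_peMr ?sqr_ge0// ler1n.
Qed.

Definition cutoff (c d : R) x : R := step (c * sqdist a x + d).

Definition dcutoff (c d : R) i x : R :=
  dstep (c * sqdist a x + d) * (c * (2 * (x 0 i - a 0 i))).

Lemma has_partial_cutoff c d i : has_partial i (cutoff c d) (dcutoff c d i).
Proof.
have := has_partial_comp (has_partial_sqdist a i) (C1_comp (@C1_step R) (C1_affine c d)).
by congr has_partial; apply/funext => x; rewrite -mulrA.
Qed.

End ball.

Section ball_perimeter.
Context (R : realType) (N : nat).
Hypothesis N_gt0 : (0 < N)%N.
Local Notation T := (caratheodory_type (@lebesgue_outer R N)).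
Local Notation leb := (lebesgueN R N).
Variables (a : 'rV[R]_N) (rho : R).
Hypothesis rho_gt0 : 0 < rho.
Implicit Types (x : 'rV[R]_N) (i j : 'I_N).
Local Notation B := (cball a (rho ^+ 2)).

(** The argument of [step] is 1 + (n + 1) (rho^2 - |x - a|^2). Hence [eta n] is 1 on [B], vanishes
    once |x - a|^2 >= rho^2 + 1 / (n + 1), and tends to the indicator of the closed ball. *)
Let eta (n : nat) := cutoff a (- n.+1%:R) (1 + n.+1%:R * rho ^+ 2).
Let deta (n : nat) := dcutoff a (- n.+1%:R) (1 + n.+1%:R * rho ^+ 2).
Let arg (n : nat) x : R := - n.+1%:R * sqdist a x + (1 + n.+1%:R * rho ^+ 2).

Let n1_gt0 (n : nat) : 0 < n.+1%:R :> R. Proof. by rewrite ltr0n. Qed.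

Let arg_ge1 n x : B x -> 1 <= arg n x.
Proof. by rewrite /cball/= /arg => xB; have := n1_gt0 n; nra. Qed.

Let arg_le0 n x : ~ cball a (rho ^+ 2 + 1) x -> arg n x <= 0.
Proof.
rewrite /cball/= /arg => /negP; rewrite -ltNge => xB.
have : 1 <= n.+1%:R :> R by rewrite ler1n.
nra.
Qed.

Let eta_support n x : ~ cball a (rho ^+ 2 + 1) x -> eta n x = 0.
Proof. by move=> /(arg_le0 n) /step_le0[]. Qed.

Let eta_cvg x : eta ^~ x @ \oo --> (\1_B x : R).
Proof.
apply: cvg_near_cst; have [xB|xB] := pselect (B x).
  rewrite indicE mem_set//; apply: nearW => n.
  by have [] := step_ge1 (arg_ge1 n xB).
rewrite indicE memNset//.
have d0 : 0 < sqdist a x - rho ^+ 2.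
  by rewrite subr_gt0 ltNge; apply/negP.
near=> n; apply: (step_le0 _).1.
have : n.+1%:R^-1 < sqdist a x - rho ^+ 2.
  by near: n; exact: (near_infty_natSinv_lt (PosNum d0)).
by rewrite -[n.+1%:R^-1]mulr1 ltr_pdivrMl// => ?; nra.
Unshelve. all: by end_near. Qed.

Let eta_bounds n x : 0 <= eta n x <= 1. Proof. exact: step_bounds. Qed.

(** The gradient of [eta n] is - k (x - a) with k >= 0, and k = 0 where the argument of [step] is at
    least 1. Elsewhere |x - a| >= rho, so y . (x - a) <= |x - a|^2 / rho: no vector of length at
    most 1 pairs better with the gradient than (x - a) / rho. *)
Let deta_bound n (y : 'I_N -> R) x : \sum_i y i ^+ 2 <= 1 ->
  - \sum_i y i * deta n i x <= - rho^-1 * \sum_i (x 0 i - a 0 i) * deta n i x.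
Proof.
move=> y1; pose k : R := 2 * n.+1%:R * dstep (arg n x).
have k0 : 0 <= k by apply: mulr_ge0; [exact: mulr_ge0|exact: dstep_ge0].
have E (w : 'I_N -> R) : \sum_i w i * deta n i x = - k * \sum_i w i * (x 0 i - a 0 i).
  rewrite mulr_sumr; apply: eq_bigr => i _.
  by rewrite /deta /dcutoff -/(arg n x) /k; ring.
rewrite !E; set S1 := \sum_i _; set S2 := \sum_i _.
rewrite (_ : - (- k * S1) = k * S1) 1?(_ : - rho^-1 * (- k * S2) = k * (rho^-1 * S2)); try by ring.
have [arg1|arg1] := leP 1 (arg n x).
  by rewrite /k (step_ge1 arg1).2 mulr0 !mul0r.
apply: ler_wpM2l => //.
have -> : S2 = sqdist a x.
  by apply: eq_bigr => i _; rewrite expr2.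
have rx : rho ^+ 2 <= sqdist a x.
  by rewrite leNgt; apply/negP => h; move: arg1; rewrite /arg; have := n1_gt0 n; nra.
(* AM-GM: [2 y c <= rho y^2 + c^2 / rho] *)
apply: (@le_trans _ _ (\sum_i (rho / 2 * y i ^+ 2 + (2 * rho)^-1 * (x 0 i - a 0 i) ^+ 2))).
  apply: ler_sum => i _; set c := _ - _; rewrite -subr_ge0.
  have -> : rho / 2 * y i ^+ 2 + (2 * rho)^-1 * c ^+ 2 - y i * c =
            (2 * rho)^-1 * (rho * y i - c) ^+ 2 by field; rewrite gt_eqF.
  by rewrite mulr_ge0 ?sqr_ge0// invr_ge0 mulr_ge0// ltW.
rewrite big_split/= -!mulr_sumr -/(sqdist a x).
apply: (@le_trans _ _ (rho / 2 + (2 * rho)^-1 * sqdist a x)).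
  by rewrite lerD2r -[leRHS]mulr1 ler_wpM2l// divr_ge0// ltW.
have -> : rho / 2 = (2 * rho)^-1 * rho ^+ 2 by field; rewrite gt_eqF.
rewrite -mulrDr (_ : rho^-1 = (2 * rho)^-1 * 2); last by field; rewrite gt_eqF.
rewrite -mulrA ler_pM2l ?invr_gt0 ?mulr_gt0//.
by lra.
Qed.

(** The upper bound for the perimeter. For each [n] the inequality holds with [eta n] in place of
    [\1_B]: by parts, then [deta_bound] pointwise, then by parts back with the field x - a of
    divergence [N]. *)
Lemma divergence_le (K : set 'rV[R]_N) (Phi dPhi : 'I_N -> 'rV[R]_N -> R) :
  compact K -> (forall i, has_partial i (Phi i) (dPhi i)) ->
  (forall i x, ~ K x -> Phi i x = 0) -> (forall x, \sum_i Phi i x ^+ 2 <= 1) ->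
  Rintegral leb setT (fun x => (\sum_i dPhi i x) * \1_B x) <=
  N%:R / rho * Rintegral leb setT (\1_B).
Proof.
move=> cK PhidPhi KPhi Phi1.
have [M _ BM] := compact_sub_cube (@compact_cball _ _ N_gt0 a (rho ^+ 2 + 1)).
have etaM n x : ~ cube M x -> eta n x = 0 by move=> xM; apply: eta_support => /BM.
have eta1 n x : `|eta n x| <= 1.
  by have /andP[e0 e1] := eta_bounds n x; rewrite ger0_norm.
have ceta n : continuous (eta n).
  by have [] := has_partial_cutoff a (- n.+1%:R) (1 + n.+1%:R * rho ^+ 2) (Ordinal N_gt0).
have cdiv : continuous (fun x => \sum_i dPhi i x).
  by apply: continuous_sum => i; have [] := PhidPhi i.
have Kdiv x : ~ K x -> \sum_i dPhi i x = 0.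
  move=> Kx; apply: big1 => i _.
  by rewrite -(has_partialE (PhidPhi i)); exact: (partial_support i cK (KPhi i)).
have [C C0 divC] := continuous_support_bounded cK cdiv Kdiv.
have cvg1 : (fun n => Rintegral leb setT (fun x => (\sum_i dPhi i x) * eta n x)) @ \oo -->
    Rintegral leb setT (fun x => (\sum_i dPhi i x) * \1_B x).
  apply: (@cube_cvg_Rintegral _ _ N_gt0 _ _ M C _ _ _ _).2.
  - by move=> n; apply: continuous_lebesgue_measurable => //; exact: continuous_mul.
  - by move=> n x; rewrite normrM -[C]mulr1 ler_pM.
  - by move=> n x /(etaM n) ->; rewrite mulr0.
  - by move=> x; apply: cvgMr; exact: eta_cvg.
have cvg2 : (fun n => Rintegral leb setT (eta n)) @ \oo --> Rintegral leb setT \1_B.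
  apply: (@cube_cvg_Rintegral _ _ N_gt0 _ _ M 1 _ _ _ _).2 => //.
  by move=> n; exact: continuous_lebesgue_measurable.
have cvg3 : (fun n => N%:R / rho * Rintegral leb setT (eta n)) @ \oo -->
    N%:R / rho * Rintegral leb setT \1_B by apply: cvgMr.
apply: (ler_cvg_to cvg1 cvg3); apply: nearW => n.
have etaP i := has_partial_cutoff a (- n.+1%:R) (1 + n.+1%:R * rho ^+ 2) i.
have cB := @compact_cball _ _ N_gt0 a (rho ^+ 2 + 1).
have PhiE := divergence_by_parts N_gt0 cB PhidPhi etaP (@eta_support n).
have yE := divergence_by_parts N_gt0 cB (fun i => has_partial_coord a i i) etaP (@eta_support n).
have cdeta i : continuous (deta n i) by have [] := etaP i.
have deta_support i x : ~ cball a (rho ^+ 2 + 1) x -> deta n i x = 0.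
  by move=> /(arg_le0 n) /step_le0[_ d0]; rewrite /deta /dcutoff d0 mul0r.
have int (f : 'rV[R]_N -> R) : continuous f -> (forall x, ~ cball a (rho ^+ 2 + 1) x -> f x = 0) ->
  leb.-integrable setT (EFin \o f) := compact_integrable N_gt0 cB.
have int_y : leb.-integrable setT (EFin \o (fun x => \sum_i (x 0 i - a 0 i) * deta n i x)).
  apply: int => [|x xB]; last by apply: big1 => i _; rewrite deta_support// mulr0.
  apply: continuous_sum => i; apply: continuous_mul => //.
  by have [] := has_partial_coord a i i.
have int_Phi : leb.-integrable setT (EFin \o (fun x => - \sum_i Phi i x * deta n i x)).
  apply: int => [|x xB]; last by rewrite big1 ?oppr0// => i _; rewrite deta_support// mulr0.
  apply: continuous_opp; apply: continuous_sum => i; apply: continuous_mul => //.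
  by have [] := PhidPhi i.
have -> : Rintegral leb setT (fun x => (\sum_i dPhi i x) * eta n x) =
          Rintegral leb setT (fun x => - \sum_i Phi i x * deta n i x).
  under [RHS]eq_Rintegral do rewrite -mulN1r.
  rewrite RintegralZl ?mulN1r ?PhiE ?opprK//.
  apply: int => [|x xB]; last by apply: big1 => i _; rewrite deta_support// mulr0.
  apply: continuous_sum => i; apply: continuous_mul => //.
  by have [] := PhidPhi i.
have -> : N%:R / rho * Rintegral leb setT (eta n) =
    Rintegral leb setT (fun x => - rho^-1 * \sum_i (x 0 i - a 0 i) * deta n i x).
  rewrite RintegralZl// yE mulrNN.
  rewrite (_ : Rintegral leb setT (fun x => _ * _) = N%:R * Rintegral leb setT (eta n)).
    by ring.
  rewrite -RintegralZl//; last exact: (int (eta n) (ceta n) (@eta_support n)).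
  apply: eq_Rintegral => x _; congr (_ * _).
  by under eq_bigr do rewrite eqxx; rewrite sumr_const card_ord.
apply: le_Rintegral => //; first exact: (integrableZl measurableT (- rho^-1) int_y).
by move=> x _; apply: deta_bound.
Qed.

End ball_perimeter.

(** * The calibrating field *)

Section ramp.
Context (R : realType).
Implicit Types (n : nat) (u : R) (G dG H dH : R -> R).

Lemma C1_sub G dG H dH : C1 G dG -> C1 H dH ->
  C1 (fun u => G u - H u) (fun u => dG u - dH u).
Proof.
move=> [Gd cdG] [Hd cdH]; split; first by move=> u; have := Gd u; have := Hd u => ? ?; exact: is_deriveB.
by apply: continuous_add => //; exact: continuous_opp.
Qed.

(** The derivative is kept as a quotient by [Q], so that bounds and limits for the power itself
    apply to it. *)
Lemma C1_powR (b : R) (Q dQ : R -> R) : (forall u, 0 < Q u) -> C1 Q dQ ->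
  C1 (fun u => Q u `^ (- b)) (fun u => - b * (Q u `^ (- b) / Q u) * dQ u).
Proof.
move=> Q0 Q1; have cQ := C1_continuous Q1; have [Qd cdQ] := Q1.
have PQ u : is_derive u 1 (fun u => Q u `^ (- b)) (- b * (Q u `^ (- b) / Q u) * dQ u).
  have Qdu := Qd u; have Pd := is_derive1_powR (- b) (Q0 u).
  have := is_derive1_comp Pd Qdu.
  rewrite powRB ?powRr1 ?(ltW (Q0 u))//.
  by apply/implyP => _; rewrite gt_eqF.
have cPQ : continuous (fun u => Q u `^ (- b)).
  by move=> u; apply: differentiable_continuous; apply/derivable1_diffP; case: (PQ u).
split=> //; apply: continuous_mul => //; apply: continuous_mul; first exact: cst_continuous.
apply: continuous_mul => // u; apply: (@cvgV _ _ (nbhs u) _ Q (Q u)); last exact: cQ.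
by rewrite gt_eqF.
Qed.

(** A C^1 smoothing of the positive part: its derivative grows linearly from 0 to 1 on the interval
    from 0 to 1 / (n + 1) and is constant outside it. *)
Definition ramp n u : R := n.+1%:R / 2 * (sqpos u - sqpos (u - n.+1%:R^-1)).
Definition dramp n u : R := n.+1%:R * (Num.max u 0 - Num.max (u - n.+1%:R^-1) 0).

Lemma C1_ramp n : C1 (ramp n) (dramp n).
Proof.
have h1 := C1_comp (@C1_sqpos R) (C1_affine 1 (- n.+1%:R^-1)).
have := C1_comp (C1_affine (n.+1%:R / 2) 0) (C1_sub (@C1_sqpos R) h1).
congr C1; apply/funext => u /=; rewrite /ramp /dramp ?addr0 ?mul1r//.
by field.
Qed.

Lemma ramp_le0 n u : u <= 0 -> ramp n u = 0 /\ dramp n u = 0.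
Proof.
move=> u0; have un : u - n.+1%:R^-1 <= 0 by rewrite subr_le0 (le_trans u0).
by rewrite /ramp /dramp /sqpos !max_r// !subrr !mulr0.
Qed.

Lemma ramp_ge n u : n.+1%:R^-1 <= u -> ramp n u = u - n.+1%:R^-1 / 2 /\ dramp n u = 1.
Proof.
move=> un; have u0 : 0 <= u by rewrite (le_trans _ un).
rewrite /ramp /dramp /sqpos !max_l ?subr_ge0//.
by split; field; rewrite ?pnatr_eq0.
Qed.

Lemma ramp_ge0 n u : 0 <= ramp n u.
Proof.
rewrite /ramp mulr_ge0 ?divr_ge0// subr_ge0 /sqpos.
have : 0 < n.+1%:R^-1 :> R by rewrite invr_gt0 ltr0n.
move: (n.+1%:R^-1 : R) => d d0.
by case: (leP u 0) => ?; case: (leP (u - d) 0) => ?; nra.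
Qed.

Lemma dramp_bounds n u : 0 <= dramp n u <= 1.
Proof.
rewrite /dramp; have k0 : 0 < n.+1%:R :> R by rewrite ltr0n.
have : n.+1%:R * n.+1%:R^-1 = 1 :> R by rewrite mulfV// gt_eqF.
have : 0 < n.+1%:R^-1 :> R by rewrite invr_gt0.
move: (n.+1%:R : R) (n.+1%:R^-1 : R) k0 => k d k0 d0 kd.
by case: (leP u 0) => ?; case: (leP (u - d) 0) => ?; apply/andP; split; nra.
Qed.

End ramp.

Section calibration.
Context (R : realType) (N : nat).
Hypothesis N_gt0 : (0 < N)%N.
Local Notation T := (caratheodory_type (@lebesgue_outer R N)).
Local Notation leb := (lebesgueN R N).
Variables (a : 'rV[R]_N) (rho : R).
Hypothesis rho_gt0 : 0 < rho.
Implicit Types (x : 'rV[R]_N) (i j : 'I_N).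
Local Notation B := (cball a (rho ^+ 2)).

Lemma has_partial_cst i (c : R) : has_partial i (fun _ : 'rV[R]_N => c) (fun=> 0).
Proof.
split; [exact: cst_continuous|exact: cst_continuous|].
by move=> x; exact: is_derive_cst.
Qed.

(** Competitors for the lower bound: (x - a) / rho2 times a cutoff. The length is at most |x - a| /
    rho2 <= 1 on the support. On [B] the cutoff is 1 with zero gradient, so the divergence there is
    that of (x - a) / rho2. *)
Lemma calibrating_field rho2 : rho < rho2 -> exists Phi dPhi : 'I_N -> 'rV[R]_N -> R,
  [/\ forall i, Ck 1 (Phi i) /\ has_partial i (Phi i) (dPhi i),
      forall i x, ~ cball a (rho2 ^+ 2) x -> Phi i x = 0,
      forall x, \sum_i Phi i x ^+ 2 <= 1 &
      forall x, B x -> \sum_i dPhi i x = N%:R / rho2].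
Proof.
move=> rho12; have rho2_gt0 : 0 < rho2 by exact: lt_trans rho12.
pose e := rho2 ^+ 2 - rho ^+ 2; have e0 : 0 < e.
  by rewrite /e subr_sqr mulr_gt0 ?subr_gt0 ?addr_gt0.
(* Chosen so that the argument of [step] is (rho2^2 - |x - a|^2) / e: at least 1 on [B], at most 0
   outside the ball of radius [rho2]. *)
pose c := - e^-1; pose d := rho2 ^+ 2 / e.
have argE x : c * sqdist a x + d = (rho2 ^+ 2 - sqdist a x) / e by rewrite /c /d; ring.
exists (fun i x => rho2^-1 * (x 0 i - a 0 i) * cutoff a c d x).
exists (fun i x => (0 * (x 0 i - a 0 i) + rho2^-1 * (i == i)%:R) * cutoff a c d x +
  rho2^-1 * (x 0 i - a 0 i) * dcutoff a c d i x).
split.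
- have h i j := has_partial_mul (has_partial_mul (has_partial_cst j rho2^-1)
    (has_partial_coord a j i)) (has_partial_cutoff a c d j).
  move=> i; split; last exact: h.
  apply: has_partial_Ck => [j|]; last by have [] := h i i.
  by eexists; exact: h.
- move=> i x /negP; rewrite -ltNge => xB.
  rewrite /cutoff (step_le0 _).1 ?mulr0// argE.
  by rewrite mulr_le0_ge0 ?invr_ge0 ?(ltW e0)// subr_le0 ltW.
- move=> x; have -> : \sum_i (rho2^-1 * (x 0 i - a 0 i) * cutoff a c d x) ^+ 2 =
      rho2^-1 ^+ 2 * cutoff a c d x ^+ 2 * sqdist a x.
    by rewrite mulr_sumr; apply: eq_bigr => i _; ring.
  have /andP[c0 c1] := step_bounds (c * sqdist a x + d); rewrite -/(cutoff a c d x) in c0 c1.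
  have [xB|xB] := leP (sqdist a x) (rho2 ^+ 2); last first.
    rewrite {1}/cutoff (step_le0 _).1 ?expr0n/= ?mulr0 ?mul0r// argE.
    by rewrite mulr_le0_ge0 ?invr_ge0 ?(ltW e0)// subr_le0 ltW.
  rewrite mulrAC exprVn -[leRHS]mulr1; apply: ler_pM => //.
  + by rewrite mulr_ge0 ?invr_ge0 ?sqr_ge0// sqdist_ge0.
  + exact: sqr_ge0.
  + by rewrite mulrC ler_pdivrMr ?mul1r// exprn_gt0.
  + by rewrite expr_le1.
- move=> x xB; have arg1 : 1 <= c * sqdist a x + d.
    by rewrite argE ler_pdivlMr// mul1r /e lerD2l lerN2.
  rewrite -[N in RHS]card_ord -sumr_const mulr_suml; apply: eq_bigr => i _.
  by rewrite /dcutoff /cutoff (step_ge1 arg1).1 (step_ge1 arg1).2 eqxx/= mulr1n; ring.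
Qed.

End calibration.

(** * The field z and its distributional divergence *)

Section radial_field.
Context (R : realType) (N : nat).
Hypothesis N_gt0 : (0 < N)%N.
Local Notation T := (caratheodory_type (@lebesgue_outer R N)).
Local Notation leb := (lebesgueN R N).
Variables (a : 'rV[R]_N) (rho : R).
Hypothesis rho_gt0 : 0 < rho.
Implicit Types (x : 'rV[R]_N) (i j : 'I_N) (s : R).
Local Notation B := (cball a (rho ^+ 2)).

Let P s : R := rho ^+ N.-1 * s `^ (- (N%:R / 2)).

Let rho2_gt0 : 0 < rho ^+ 2. Proof. exact: exprn_gt0. Qed.

Let powR_sqr (c : R) : 0 < c -> (c ^+ 2) `^ (- (N%:R / 2)) = (c ^+ N)^-1.
Proof.
move=> c0; rewrite powRN -powR_mulrn ?(ltW c0)// -powRrM.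
by rewrite mulrCA divff ?mulr1 ?powR_mulrn// ltW.
Qed.

Let P_sqr (c : R) : 0 < c -> P (c ^+ 2) = rho ^+ N.-1 / c ^+ N.
Proof. by move=> c0; rewrite /P powR_sqr. Qed.

Let P_rho : P (rho ^+ 2) = rho^-1.
Proof.
by rewrite P_sqr// -[in X in _ / X](prednK N_gt0) exprS invfM mulrCA divff ?mulr1// expf_neq0// gt_eqF.
Qed.

Let P_ge0 s : 0 <= P s. Proof. by rewrite mulr_ge0 ?powR_ge0// exprn_ge0// ltW. Qed.

Let P_le s : rho ^+ 2 <= s -> P s <= rho^-1.
Proof.
move=> rs; rewrite -P_rho /P ler_wpM2l ?exprn_ge0 ?(ltW rho_gt0)//.
have s0 : 0 < s by exact: lt_le_trans rs.
rewrite !powRN lef_pV2 ?posrE ?powR_gt0//.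
by apply: ge0_ler_powR; rewrite ?nnegrE ?divr_ge0 ?(ltW s0) ?(ltW rho2_gt0).
Qed.

Let P_cvg s : 0 < s -> {for s, continuous P}.
Proof.
move=> s0; have cp : {for s, continuous (fun s => s `^ (- (N%:R / 2)))}.
  apply: differentiable_continuous; apply/derivable1_diffP.
  by case: (is_derive1_powR (- (N%:R / 2)) s0).
apply: (@cvgM _ _ (nbhs s) _ (cst (rho ^+ N.-1)) (fun s => s `^ (- (N%:R / 2)))) => //.
exact: cvg_cst.
Qed.

(** The maximum glues the two formulas for z. The profile [P] at |x - a|^2 gives rho^(N-1) / |x -
    a|^N, and [P (rho ^+ 2)] is 1 / rho, so the field is continuous across the sphere. *)
Definition radial_field i x : R := - (x 0 i - a 0 i) * P (Num.max (sqdist a x) (rho ^+ 2)).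

Let sup_gt0 s : 0 < Num.max s (rho ^+ 2).
Proof. by rewrite lt_max rho2_gt0 orbT. Qed.

Lemma continuous_radial_field i : continuous (radial_field i).
Proof.
apply: continuous_mul.
  by apply: continuous_opp; have [] := has_partial_coord a i i.
move=> x; apply: (@continuous_comp _ _ _ (fun x => Num.max (sqdist a x) (rho ^+ 2)) P x).
  apply: (@continuous_max R 'rV[R]_N (sqdist a) (cst (rho ^+ 2)) x).
    exact: continuous_sqdist.
  exact: cst_continuous.
exact: P_cvg.
Qed.

Lemma radial_field_le1 x : \sum_i radial_field i x ^+ 2 <= 1.
Proof.
set Q := Num.max (sqdist a x) (rho ^+ 2).
have -> : \sum_i radial_field i x ^+ 2 = P Q ^+ 2 * sqdist a x.
  by rewrite mulr_sumr; apply: eq_bigr => i _; rewrite /radial_field -/Q; ring.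
have Q0 : 0 < Q by exact: sup_gt0.
pose c := Num.sqrt Q; have c0 : 0 < c by rewrite sqrtr_gt0.
have cQ : Q = c ^+ 2 by rewrite sqr_sqrtr// ltW.
have rc : rho <= c.
  by rewrite -ler_sqr ?nnegrE ?(ltW rho_gt0) ?(ltW c0)// -cQ le_max lexx orbT.
apply: (@le_trans _ _ (P Q ^+ 2 * Q)).
  by rewrite ler_wpM2l ?sqr_ge0// le_max lexx.
rewrite cQ P_sqr//.
have -> : (rho ^+ N.-1 / c ^+ N) ^+ 2 * c ^+ 2 = ((rho / c) ^+ N.-1) ^+ 2.
  have -> : c ^+ N = c * c ^+ N.-1 by rewrite -exprS prednK.
  have : c ^+ N.-1 != 0 by rewrite expf_neq0// gt_eqF.
  rewrite (expr_div_n rho c); move: (c ^+ N.-1) (rho ^+ N.-1) => m p m0.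
  by field; rewrite m0 gt_eqF.
rewrite exprn_ile1// ?exprn_ile1 ?exprn_ge0 ?divr_ge0 ?(ltW c0) ?(ltW rho_gt0)//.
by rewrite ler_pdivrMr ?mul1r.
Qed.

(** A C^1 version of the maximum of [s] and rho^2. It never drops below rho^2, which keeps the
    negative power bounded. *)
Let Q n s := ramp n (s - rho ^+ 2) + rho ^+ 2.
Let dQ n s := dramp n (s - rho ^+ 2).

Let C1_Q n : C1 (Q n) (dQ n).
Proof.
have := C1_comp (C1_affine 1 (rho ^+ 2)) (C1_comp (C1_ramp R n) (C1_affine 1 (- rho ^+ 2))).
by congr C1; apply/funext => s; rewrite ?mulr1 !mul1r.
Qed.

Let Q_ge n s : rho ^+ 2 <= Q n s. Proof. by rewrite lerDr ramp_ge0. Qed.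

Let Q_gt0 n s : 0 < Q n s. Proof. exact: lt_le_trans (Q_ge n s). Qed.

Let C1_PQ n : C1 (fun s => P (Q n s)) (fun s => - (N%:R / 2) * (P (Q n s) / Q n s) * dQ n s).
Proof.
have := C1_comp (C1_affine (rho ^+ N.-1) 0) (C1_powR (N%:R / 2) (Q_gt0 n) (C1_Q n)).
by congr C1; apply/funext => s; rewrite /P ?addr0//; ring.
Qed.

Let Q_cvg s : Q ^~ s @ \oo --> Num.max s (rho ^+ 2).
Proof.
have [sr|rs] := leP s (rho ^+ 2).
  apply: cvg_near_cst; apply: nearW => n.
  by rewrite /Q (ramp_le0 n _).1 ?add0r// subr_le0.
have d0 : 0 < s - rho ^+ 2 by rewrite subr_gt0.
apply/cvgrPdist_le => e e0; near=> n.
have nd : n.+1%:R^-1 < s - rho ^+ 2.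
  by near: n; exact: (near_infty_natSinv_lt (PosNum d0)).
have ne : n.+1%:R^-1 < e by near: n; exact: (near_infty_natSinv_lt (PosNum e0)).
have n0 : 0 <= n.+1%:R^-1 :> R by rewrite invr_ge0.
rewrite /Q (ramp_ge (ltW nd)).1 ler_norml.
by move: (n.+1%:R^-1 : R) ne n0 => d ? ?; apply/andP; split; lra.
Unshelve. all: by end_near. Qed.

Let dQ_cvg s : dQ ^~ s @ \oo --> ((rho ^+ 2 < s)%R%:R : R).
Proof.
apply: cvg_near_cst; have [sr|rs] := leP s (rho ^+ 2).
  by apply: nearW => n; rewrite /dQ (ramp_le0 n _).2// subr_le0.
have d0 : 0 < s - rho ^+ 2 by rewrite subr_gt0.
near=> n; rewrite /dQ (ramp_ge _).2//.
by apply: ltW; near: n; exact: (near_infty_natSinv_lt (PosNum d0)).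
Unshelve. all: by end_near. Qed.

Let PQ_cvg s : (fun n => P (Q n s)) @ \oo --> P (Num.max s (rho ^+ 2)).
Proof. by apply: continuous_cvg (@Q_cvg s); exact: P_cvg. Qed.

(** The divergence of (x - a) P(Q n |x - a|^2) at |x - a|^2 = s. *)
Let div n s : R := N%:R * (P (Q n s) - P (Q n s) / Q n s * dQ n s * s).

(** Outside the ball [Q n s] tends to [s] and [dQ n s] to 1, so the two terms cancel: this is where
    the exponent of [P] matters. On the sphere [dQ n s] is 0, whence the indicator of the closed
    ball. *)
Let div_cvg s : div ^~ s @ \oo --> N%:R / rho * (s <= rho ^+ 2)%R%:R.
Proof.
have -> : N%:R / rho * (s <= rho ^+ 2)%R%:R = N%:R * (P (Num.max s (rho ^+ 2)) -
    P (Num.max s (rho ^+ 2)) / Num.max s (rho ^+ 2) * (rho ^+ 2 < s)%R%:R * s).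
  have [sr|rs] := leP s (rho ^+ 2); first by rewrite P_rho /= mulr0 mul0r subr0 mulr1.
  have s0 : s != 0 by rewrite gt_eqF// (lt_trans _ rs).
  by rewrite /= mulr0 mulr1 divfK// subrr mulr0.
apply: cvgMr; apply: cvgB; first exact: PQ_cvg.
apply: cvgMl; apply: cvgM; last exact: dQ_cvg.
by apply: cvgM; [exact: PQ_cvg|apply: cvgV; [rewrite gt_eqF|exact: Q_cvg]].
Qed.

Let div_bound n s : 0 <= s -> `|div n s| <= N%:R / rho * (1 + s / rho ^+ 2).
Proof.
move=> s0; have -> : div n s = N%:R * (P (Q n s) * (1 - dQ n s * (s / Q n s))).
  by rewrite /div; ring.
rewrite 2!normrM (ger0_norm (ler0n R N)) (ger0_norm (P_ge0 _)) -[leRHS]mulrA.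
rewrite ler_wpM2l//.
apply: ler_pM => //; first exact: P_le.
have sQ : 0 <= s / Q n s <= s / rho ^+ 2.
  by rewrite divr_ge0 ?(ltW (Q_gt0 n s))//= ler_wpM2l// lef_pV2 ?posrE.
have := dramp_bounds n (s - rho ^+ 2); rewrite -/(dQ n s) => d01.
move: (s / Q n s) (s / rho ^+ 2) sQ (dQ n s) d01 => u v /andP[u0 uv] d /andP[d0 d1].
by rewrite ler_norml; apply/andP; split; nra.
Qed.

(** Says that div z is - (N / rho) times the indicator of [B]. The smoothed fields are integrated by
    parts classically, and both sides converge; the limit has no part carried by the sphere because
    the smoothed divergences are bounded uniformly in [n] on compact sets. *)
Lemma radial_field_divergence (K : set 'rV[R]_N) phi (dphi : 'I_N -> 'rV[R]_N -> R) :
  compact K -> (forall i, has_partial i phi (dphi i)) -> (forall x, ~ K x -> phi x = 0) ->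
  leb.-integrable setT (EFin \o (fun x => \sum_i radial_field i x * dphi i x)) /\
  Rintegral leb setT (fun x => \sum_i radial_field i x * dphi i x) =
  Rintegral leb setT (fun x => N%:R / rho * \1_B x * phi x).
Proof.
move=> cK phidphi Kphi.
have [M _ KM] := compact_sub_cube cK.
have Kdphi i x : ~ K x -> dphi i x = 0.
  by move=> Kx; rewrite -(has_partialE (phidphi i)); exact: partial_support Kphi _ Kx.
have y_partial i := has_partial_coord a i i.
pose Y x := \sum_i (x 0 i - a 0 i) * dphi i x.
have cY : continuous Y.
  apply: continuous_sum => i; apply: continuous_mul.
    by have [] := y_partial i.
  by have [] := phidphi i.
have KY x : ~ K x -> Y x = 0 by move=> Kx; apply: big1 => i _; rewrite Kdphi// mulr0.
have [C C0 YC] := continuous_support_bounded cK cY KY.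
have cs := @continuous_sqdist _ _ N_gt0 a.
have cphi : continuous phi by have [] := phidphi (Ordinal N_gt0).
(* The bound [div_bound] grows with the distance; the compact support of [phi] absorbs the
   growth. *)
have [C' C'0 phiC'] : exists2 C', 0 <= C' & forall x, `|(1 + sqdist a x / rho ^+ 2) * phi x| <= C'.
  apply: (continuous_support_bounded cK) => [|x /Kphi ->]; last by rewrite mulr0.
  apply: continuous_mul => //; apply: continuous_add; first exact: cst_continuous.
  by apply: continuous_mul => //; exact: cst_continuous.
have cPQ n : continuous (fun x => P (Q n (sqdist a x))).
  apply: (@continuous_comp_fun _ _ _ (sqdist a) (fun s => P (Q n s)) cs).
  exact: C1_continuous (C1_PQ n).
pose dPQ n s := - (N%:R / 2) * (P (Q n s) / Q n s) * dQ n s.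
have divE n x : \sum_(i < N) ((i == i)%:R * P (Q n (sqdist a x)) +
    (x 0 i - a 0 i) * (dPQ n (sqdist a x) * (2 * (x 0 i - a 0 i)))) = div n (sqdist a x).
  have sumN : \sum_(i < N) (i == i)%:R = N%:R :> R.
    by under eq_bigr do rewrite eqxx; rewrite sumr_const card_ord.
  rewrite big_split/= -mulr_suml sumN.
  have -> : \sum_i (x 0 i - a 0 i) * (dPQ n (sqdist a x) * (2 * (x 0 i - a 0 i))) =
      2 * dPQ n (sqdist a x) * sqdist a x.
    by rewrite mulr_sumr; apply: eq_bigr => i _; ring.
  by rewrite /div /dPQ; field; rewrite gt_eqF.
have Z_partial n i : has_partial i (fun x => (x 0 i - a 0 i) * P (Q n (sqdist a x)))
    (fun x => (i == i)%:R * P (Q n (sqdist a x)) +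
              (x 0 i - a 0 i) * (dPQ n (sqdist a x) * (2 * (x 0 i - a 0 i)))).
  exact: has_partial_mul (y_partial i) (has_partial_comp (has_partial_sqdist a i) (C1_PQ n)).
have cdiv n : continuous (fun x => div n (sqdist a x)).
  rewrite (_ : (fun x => _) = fun x => \sum_(i < N) ((i == i)%:R * P (Q n (sqdist a x)) +
    (x 0 i - a 0 i) * (dPQ n (sqdist a x) * (2 * (x 0 i - a 0 i))))).
    by apply: continuous_sum => i; have [] := Z_partial n i.
  by apply/funext => x; rewrite divE.
pose F n x := - P (Q n (sqdist a x)) * Y x.
pose H n x := div n (sqdist a x) * phi x.
have FH n : Rintegral leb setT (F n) = Rintegral leb setT (H n).
  have intPY : leb.-integrable setT (EFin \o (fun x => P (Q n (sqdist a x)) * Y x)).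
    apply: (compact_integrable N_gt0 cK); first exact: continuous_mul.
    by move=> x /KY ->; rewrite mulr0.
  transitivity (Rintegral leb setT (fun x => -1 * (P (Q n (sqdist a x)) * Y x))).
    by apply: eq_Rintegral => x _; rewrite /F; ring.
  rewrite RintegralZl// mulN1r.
  have := divergence_by_parts N_gt0 cK (Z_partial n) phidphi Kphi.
  rewrite (_ : (fun x => _ * phi x) = H n); last by apply/funext => x; rewrite divE.
  move=> E; rewrite -[RHS]opprK -E; congr (- _); apply: eq_Rintegral => x _.
  by rewrite mulr_sumr; apply: eq_bigr => i _; ring.
have F_cvg x : F ^~ x @ \oo --> \sum_i radial_field i x * dphi i x.
  have -> : \sum_i radial_field i x * dphi i x = - P (Num.max (sqdist a x) (rho ^+ 2)) * Y x.
    by rewrite mulr_sumr; apply: eq_bigr => i _; rewrite /radial_field; ring.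
  by apply: cvgMl; apply: cvgN; exact: PQ_cvg.
have H_cvg x : H ^~ x @ \oo --> N%:R / rho * \1_B x * phi x.
  apply: cvgMl; have := @div_cvg (sqdist a x).
  rewrite indicE; suff -> : (x \in B) = (sqdist a x <= rho ^+ 2) by [].
  by apply/idP/idP; rewrite inE.
have [|||intF cvgF] := @cube_cvg_Rintegral _ _ N_gt0 F _ M (rho^-1 * C) _ _ _ F_cvg.
- move=> n; apply: continuous_lebesgue_measurable => //.
  by apply: continuous_mul => //; exact: continuous_opp.
- move=> n x; rewrite normrM normrN (ger0_norm (P_ge0 _)); apply: ler_pM => //.
  exact: P_le.
- by move=> n x xM; rewrite /F KY ?mulr0// => /KM.
have [|||_ cvgH] := @cube_cvg_Rintegral _ _ N_gt0 H _ M (N%:R / rho * C') _ _ _ H_cvg.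
- by move=> n; apply: continuous_lebesgue_measurable => //; exact: continuous_mul.
- move=> n x; rewrite normrM; apply: le_trans (ler_wpM2r (normr_ge0 _) (div_bound _ _)) _.
    exact: sqdist_ge0.
  rewrite -[leLHS]mulrA ler_wpM2l ?divr_ge0 ?(ltW rho_gt0)//; apply: le_trans (phiC' x).
  by rewrite normrM ler_wpM2r// ler_norm.
- by move=> n x xM; rewrite /H Kphi ?mulr0// => /KM.
split => //; apply: (cvg_unique (@norm_hausdorff _ _) cvgF).
by rewrite (_ : (fun n => _) = (fun n => Rintegral leb setT (H n))) //; apply/funext.
Qed.

End radial_field.

(** * Balls as solutions *)

Section ball_variation.
Context (R : realType) (N : nat).
Hypothesis N_gt0 : (0 < N)%N.
Local Notation T := (caratheodory_type (@lebesgue_outer R N)).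
Local Notation leb := (lebesgueN R N).
Implicit Types (D K : set 'rV[R]_N) (x : 'rV[R]_N) (i j : 'I_N) (M : R).

Lemma compact_cube M : compact (cube M : set 'rV[R]_N).
Proof.
rewrite (_ : cube M = [set v | forall i, `[- M, M]%classic (v ord0 i)]).
  by apply: (@rV_compact _ _ (fun=> `[- M, M]%classic)) => i; exact: segment_compact.
by apply/seteqP; split => x xM i; have := xM i; rewrite /= !mxE ?in_itv.
Qed.

Lemma integral_support D (f : 'rV[R]_N -> R) : (forall x, ~ D x -> f x = 0) ->
  (\int[leb]_(x in D) (f x)%:E = \int[leb]_x (f x)%:E)%E.
Proof.
move=> Df; rewrite integral_mkcond; apply: eq_integral => x _.
by rewrite patchE; case: ifPn => //; rewrite notin_setE => /Df ->.
Qed.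

Lemma integrable_EFin (f : 'rV[R]_N -> R) : leb.-integrable setT (EFin \o f) ->
  (\int[leb]_x (f x)%:E = (Rintegral leb setT f)%:E)%E.
Proof. by move=> intf; rewrite /Rintegral fineK//; exact: integrable_fin_num. Qed.

Lemma enorm_sqr (x : 'rV[R]_N) : enorm x ^+ 2 = \sum_i x 0 i ^+ 2.
Proof. by rewrite sqr_sqrtr// sumr_ge0// => i _; exact: sqr_ge0. Qed.

Lemma enorm_le1 (x : 'rV[R]_N) : (enorm x <= 1) = (\sum_i x 0 i ^+ 2 <= 1).
Proof. by rewrite -enorm_sqr expr_le1// sqrtr_ge0. Qed.

Variables (a : 'rV[R]_N) (rho rho1 c : R) (D : set 'rV[R]_N).
Hypotheses (rho_gt0 : 0 < rho) (rho1_gt : rho < rho1) (c_gt0 : 0 < c).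
Hypothesis ballD : cball a (rho1 ^+ 2) `<=` D.
Local Notation B := (cball a (rho ^+ 2)).
Local Notation L := (Rintegral leb setT (\1_B)).

Let BD : B `<=` D.
Proof.
move=> x xB; apply: ballD; apply: le_trans xB _.
by rewrite lerXn2r ?nnegrE ?ltW// (lt_trans rho_gt0).
Qed.

Definition ball_fun x : R := c * \1_B x.

Lemma integrable_bounded_ball (f : 'rV[R]_N -> R) C : measurable_fun setT (f : T -> R) ->
  (forall x, `|f x| <= C) -> leb.-integrable setT (EFin \o (fun x => f x * \1_B x)).
Proof.
move=> mf fC; have [M _ BM] := compact_sub_cube (@compact_cball _ _ N_gt0 a (rho ^+ 2)).
apply: (@cube_integrable _ _ N_gt0 _ M C).
- apply: measurable_funM => //; apply: measurable_indic; exact: measurable_cball.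
- move=> x; rewrite normrM indicE; case: (_ \in _); rewrite ?normr1 ?mulr1 ?normr0 ?mulr0//.
  exact: le_trans (fC x).
- by move=> x xM; rewrite indicE memNset ?mulr0// => /BM.
Qed.

Lemma integrable_indic_ball : leb.-integrable setT (EFin \o (\1_B : 'rV[R]_N -> R)).
Proof.
have m1 : measurable_fun setT (cst 1 : T -> R) by exact: measurable_cst.
have := @integrable_bounded_ball (cst 1) 1 m1 (fun=> ltac:(by rewrite normr1)).
by congr (integrable _ _ (EFin \o _)); apply/funext => x; rewrite mul1r.
Qed.

Lemma integrable_ball_fun : leb.-integrable setT (EFin \o ball_fun).
Proof.
by apply: (@integrable_bounded_ball (cst c) `|c|) => //; exact: measurable_cst.
Qed.

Lemma Rintegral_indic_ball_ge0 : 0 <= L.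
Proof. by apply: Rintegral_ge0 => x _; rewrite /indic ler0n. Qed.

Lemma integral_ball_divergence (phi : 'rV[R]_N -> 'rV[R]_N) K : compact K ->
  (forall i, has_partial i (fun y => phi y 0 i) (partial i (fun y => phi y 0 i))) ->
  (forall i x, ~ K x -> phi x 0 i = 0) ->
  (\int[leb]_(x in D) (ball_fun x * divergence phi x)%:E =
   (c * Rintegral leb setT (fun x => divergence phi x * \1_B x))%:E)%E.
Proof.
move=> cK phiP Kphi.
have cdiv : continuous (divergence phi).
  by apply: continuous_sum => i; have [] := phiP i.
have [C _ divC] : exists2 C, 0 <= C & forall x, `|divergence phi x| <= C.
  apply: (continuous_support_bounded cK cdiv) => x Kx; apply: big1 => i _.
  exact: (partial_support i cK (Kphi i)).
rewrite integral_support; last first.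
  by move=> x xD; rewrite /ball_fun indicE memNset ?mulr0 ?mul0r// => /BD.
have intdiv := integrable_bounded_ball (continuous_lebesgue_measurable N_gt0 cdiv measurableT) divC.
under eq_integral do rewrite /ball_fun -mulrA [\1_B _ * _]mulrC.
by rewrite integrable_EFin ?RintegralZl//; exact: (integrableZl measurableT c intdiv).
Qed.

(** The upper bound is [divergence_le]. For the lower bound, the gap between [rho] and [rho1] leaves
    room in [D] for calibrating fields with radii decreasing to [rho]. *)
Lemma gradient_variation_ball :
  gradient_variation D ball_fun = (c * (N%:R / rho * L))%:E.
Proof.
apply/eqP; rewrite eq_le; apply/andP; split.
  apply: ge_ereal_sup => _ [phi [phiP phi1] <-].
  have /choice[M MP] i : exists M : R, 0 < M /\
      (forall x, ~ cube M x -> phi x 0 i = 0).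
    have [_ [cS _]] := phiP i; have [M M0 SM] := compact_sub_cube cS.
    exists M; split=> // x xM; apply: contrapT => /eqP phix; apply: xM; apply: SM.
    exact: subset_closure.
  (* The components of a test field have separate supports; the sum of the sizes yields a common
     cube. *)
  have Kphi i x : ~ cube (\sum_j M j) x -> phi x 0 i = 0.
    move=> xM; apply: (MP i).2 => /cubeP xMi; apply: xM; apply/cubeP => j.
    apply: le_trans (xMi j) _; rewrite (bigD1 i)//= lerDl sumr_ge0// => k _.
    by rewrite ltW// (MP k).1.
  have phiP' i := Ck_has_partial i (phiP i).1.
  rewrite (integral_ball_divergence (@compact_cube _) phiP' Kphi) lee_fin ler_pM2l//.
  apply: (@divergence_le R N N_gt0 a rho rho_gt0 _ (fun i x => phi x 0 i)
    (fun i => partial i (fun y => phi y 0 i)) (@compact_cube _) phiP' Kphi).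
  by move=> x; rewrite -enorm_le1.
apply/lee_addgt0Pr => e e0.
have sup_ge rho2 : rho < rho2 -> rho2 <= rho1 ->
    ((c * (N%:R / rho2 * L))%:E <= gradient_variation D ball_fun)%E.
  move=> rho12 rho21; have rho20 : 0 < rho2 by exact: lt_trans rho12.
  have [Phi [dPhi [PhiP KPhi Phi1 PhiB]]] := calibrating_field a rho_gt0 rho12.
  pose phi x : 'rV[R]_N := \row_i Phi i x.
  have phiE i : (fun y => phi y 0 i) = Phi i by apply/funext => x; rewrite mxE.
  have pE i : partial i (Phi i) = dPhi i by apply: has_partialE; exact: (PhiP i).2.
  have cball2 := @compact_cball _ _ N_gt0 a (rho2 ^+ 2).
  have SB i : closure [set x | Phi i x != 0] `<=` cball a (rho2 ^+ 2).
    have /closure_id -> := @closed_cball _ _ N_gt0 a (rho2 ^+ 2).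
    apply: closure_subset => x /eqP Phix; apply: contrapT => xB; apply: Phix.
    exact: KPhi.
  have phiC1 i : has_partial i (fun y => phi y 0 i) (partial i (fun y => phi y 0 i)).
    by rewrite phiE pE; exact: (PhiP i).2.
  have -> : (c * (N%:R / rho2 * L))%:E =
      (\int[leb]_(x in D) (ball_fun x * divergence phi x)%:E)%E.
    rewrite (integral_ball_divergence cball2 phiC1); last first.
      by move=> i x /KPhi; rewrite mxE; exact.
    congr (c * _)%:E; rewrite -RintegralZl//; last first.
      exact: integrable_indic_ball.
    apply: eq_Rintegral => x _; rewrite indicE.
    have [xB|xB] := boolP (x \in B); last by rewrite !mulr0.
    congr (_ * _); rewrite -(PhiB x); last by move: xB; rewrite inE.
    by apply: eq_bigr => i _; rewrite phiE pE.
  apply: ereal_sup_ubound; exists phi => //; split.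
    move=> i; rewrite phiE; split; first exact: (PhiP i).1.
    split; first by apply: (subclosed_compact _ cball2 (SB i)); exact: closed_closure.
    apply: subset_trans (SB i) _; apply: subset_trans ballD => x /= xB.
    apply: le_trans xB _; rewrite lerXn2r ?nnegrE ?(ltW rho20)//.
    by rewrite (le_trans (ltW rho20)).
  move=> x; rewrite enorm_le1; apply: le_trans (Phi1 x).
  by under eq_bigr do rewrite mxE.
pose A := c * N%:R * L; have A0 : 0 <= A by rewrite !mulr_ge0 ?Rintegral_indic_ball_ge0// ltW.
(* The radius rho + d loses A d / (rho (rho + d)), which this choice keeps below [e]; the summand 1
   avoids a division by 0. *)
pose d := Num.min (rho1 - rho) (e * rho ^+ 2 / (A + 1)).
have A1 : 0 < A + 1 by rewrite ltr_wpDl.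
have d0 : 0 < d by rewrite lt_min subr_gt0 rho1_gt divr_gt0// mulr_gt0// exprn_gt0.
have dA : d * (A + 1) <= e * rho ^+ 2 by rewrite -ler_pdivlMr// ge_min lexx orbT.
have dr : rho + d <= rho1 by rewrite addrC -lerBrDr ge_min lexx.
apply: le_trans (leeD (sup_ge (rho + d) _ dr) (lexx _)); last by rewrite ltrDl.
rewrite -EFinD lee_fin.
have rd0 : 0 < rho + d by rewrite addr_gt0.
rewrite -subr_ge0.
have -> : c * (N%:R / (rho + d) * L) + e - c * (N%:R / rho * L) =
    (e * rho * (rho + d) - A * d) / (rho * (rho + d)).
  by rewrite /A; field; rewrite !gt_eqF.
rewrite divr_ge0 ?mulr_ge0 ?(ltW rho_gt0) ?(ltW rd0)// subr_ge0.
have erd : 0 <= e * rho * d by rewrite !mulr_ge0// ltW.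
by move: dA erd d0; rewrite expr2; nra.
Qed.

End ball_variation.

(** * Verification of the conditions defining a solution *)

Section ball_solution.
Context (R : realType) (N : nat).
Hypothesis N_gt0 : (0 < N)%N.
Local Notation T := (caratheodory_type (@lebesgue_outer R N)).
Local Notation leb := (lebesgueN R N).
Implicit Types (x : 'rV[R]_N) (i j : 'I_N) (D : set 'rV[R]_N).

Lemma norm_p_infty_le D (f : 'rV[R]_N -> R) (C : R) : 0 <= C ->
  (forall x, D x -> `|f x| <= C) -> (norm_p D +oo f <= C%:E)%E.
Proof.
move=> C0 fC; rewrite /norm_p unlock; case: ifP => // _.
rewrite (_ : abse \o _ = EFin \o (fun x => `|(f \_ D) x|))//.
apply: ess_sup_inf.ess_sup_ler => x; rewrite lee_fin patchE.
by case: ifPn => [|_]; rewrite ?normr0// inE => /fC.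
Qed.

Lemma norm_p_bounded_lty D (f : 'rV[R]_N -> R) (M C : R) (p : R) : 0 < p ->
  measurable_fun setT (f : T -> R) -> (forall x, ~ D x -> f x = 0) ->
  (forall x, ~ cube M x -> f x = 0) -> (forall x, `|f x| <= C) ->
  (norm_p D p%:E f < +oo)%E.
Proof.
move=> p0 mf Df Mf fC; rewrite /norm_p unlock; apply: poweR_lty.
have -> : f \_ D = f.
  by apply/funext => x; rewrite patchE; case: ifPn => //; rewrite notin_setE => /Df ->.
rewrite (_ : (\int[leb]_x _)%E = (\int[leb]_x (`|f x| `^ p)%:E)%E)//.
apply: integrable_lty => //.
apply: (@cube_integrable _ _ N_gt0 (fun x => `|f x| `^ p) M (C `^ p)).
- apply: (@measurableT_comp _ _ _ _ _ _ (fun y : R => y `^ p)); first exact: measurable_powR.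
  exact: measurableT_comp.
- move=> x; rewrite ger0_norm ?powR_ge0//; apply: ge0_ler_powR; rewrite ?nnegrE// ?(ltW p0)//.
  exact: le_trans (fC x).
- by move=> x /Mf ->; rewrite normr0 powR0// gt_eqF.
Qed.

(** A boundary point of the open set [D] has a neighbourhood that misses [B], so the averages
    defining the trace are 0 for small radii. *)
Lemma trace_zero D (u : 'rV[R]_N -> R) (B : set 'rV[R]_N) : open D -> closed B -> B `<=` D ->
  (forall x, ~ B x -> u x = 0) -> is_trace D u (fun=> 0).
Proof.
move=> oD cB BD uB; split; first exact: integrable0.
apply: aeW => x [_ iDx].
have xB : ~ B x by move=> /BD Dx; apply: iDx; have /interior_id -> := oD.
have oB : open (~` B) by exact: closed_openC.
have /nbhs_ballP[e /= e0 xe] : nbhs x (~` B) by exact: open_nbhs_nbhs.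
apply: cvg_near_cst; near=> rho.
rewrite [X in (_ * X)%E](_ : _ = 0%E) ?mule0//; apply: (@integral0_eq _ _ _ leb) => y [_ xy].
rewrite uB ?subrr ?normr0//; apply: xe; split => // k i.
rewrite (ord1 k) /ball /= distrC.
have re : rho < e by near: rho; exact: nbhs_right_lt.
(* The neighbourhood is a ball for the sup norm, and each coordinate is bounded by the Euclidean
   norm. *)
apply: le_lt_trans (lt_trans xy re); rewrite /enorm -sqrtr_sqr ler_wsqrtr//.
by rewrite (bigD1 i)//= !mxE lerDl; apply: sumr_ge0 => l _; exact: sqr_ge0.
Unshelve. all: by end_near. Qed.

Variables (a : 'rV[R]_N) (rho rho1 c lambda q : R) (D : set 'rV[R]_N).
Hypotheses (rho_gt0 : 0 < rho) (rho1_gt : rho < rho1) (c_gt0 : 0 < c).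
Hypotheses (oD : open D) (ballD : cball a (rho1 ^+ 2) `<=` D).
Local Notation B := (cball a (rho ^+ 2)).

Hypothesis c_eq : lambda * c `^ (q - 1) + c `^ (crit_exp R N - 1) = 1 + N%:R / rho.

Let BD : B `<=` D.
Proof.
move=> x xB; apply: ballD; apply: le_trans xB _.
by rewrite lerXn2r ?nnegrE ?ltW// (lt_trans rho_gt0).
Qed.

Let mD : measurable (D : set T). Proof. exact: open_lebesgue_measurable. Qed.

Let mB : measurable_fun setT (\1_B : T -> R).
Proof. by apply: measurable_indic; exact: measurable_cball. Qed.

Let powR_sub1 (s : R) : c `^ (s - 2) * c = c `^ (s - 1).
Proof.
rewrite -[X in _ * X](powRr1 (ltW c_gt0)) -powRD; last by rewrite (gt_eqF c_gt0) implybT.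
by congr powR; ring.
Qed.

Let indic_ball x : (\1_B x = 1 :> R /\ B x) \/ (\1_B x = 0 :> R /\ ~ B x).
Proof.
by have [xB|xB] := pselect (B x); [left|right]; rewrite indicE ?(mem_set xB) ?(memNset xB).
Qed.

Lemma is_solution_ball : is_solution lambda q D (ball_fun a rho c).
Proof.
have NR0 : 0 <= N%:R / rho by rewrite divr_ge0// ltW.
have gvE := gradient_variation_ball N_gt0 rho_gt0 rho1_gt c_gt0 ballD.
split.
  split; last by rewrite gvE ltry.
  by apply: integrableS (integrable_ball_fun N_gt0 a rho c).
pose w x : R := - (N%:R / rho) * \1_B x.
have mw : measurable_fun setT (w : T -> R) by apply: measurable_funM.
have wD x : ~ D x -> w x = 0.
  by move=> xD; rewrite /w indicE memNset ?mulr0// => /BD.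
have w_le x : `|w x| <= N%:R / rho.
  rewrite normrM normrN (ger0_norm NR0); case: (indic_ball x) => -[-> _].
    by rewrite normr1 mulr1.
  by rewrite normr0 mulr0.
(* Off the ball both div z and the right-hand side vanish, which forces gamma to be 0 there; on the
   ball u > 0 forces gamma = 1. *)
exists (fun x => \row_i radial_field a rho i x), \1_B, w, (fun=> 0); split.
- split.
    move=> i; apply: continuous_lebesgue_measurable => //.
    rewrite (_ : (fun x => _) = radial_field a rho i); first exact: continuous_radial_field.
    by apply/funext => x; rewrite mxE.
  apply: norm_p_infty_le => // x _; rewrite ger0_norm ?sqrtr_ge0// enorm_le1.
  by under eq_bigr do rewrite mxE; exact: radial_field_le1.
- split.
  + move=> phi phiC [cK KD]; set K := closure _ in cK KD.
    have Kphi x : ~ K x -> phi x = 0.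
      by move=> Kx; apply: contrapT => /eqP phix; apply: Kx; exact: subset_closure.
    have phiP i : has_partial i phi (partial i phi) by apply: Ck_has_partial; exact: phiC.
    have [intz zE] := radial_field_divergence N_gt0 a rho_gt0 cK phiP Kphi.
    have cphi : continuous phi by have [] := phiC 0%N.
    have [C _ phi_le] := continuous_support_bounded cK cphi Kphi.
    have mphi := continuous_lebesgue_measurable N_gt0 cphi measurableT.
    have int_phi := integrable_bounded_ball N_gt0 a rho mphi phi_le.
    rewrite (_ : (fun x => _) = fun x => (\sum_i radial_field a rho i x * partial i phi x)%:E); last first.
      by apply/funext => x; congr EFin; apply: eq_bigr => i _; rewrite mxE.
    have zD x : ~ D x -> \sum_i radial_field a rho i x * partial i phi x = 0.
      move=> xD; apply: big1 => i _; rewrite (partial_support i cK Kphi) ?mulr0//.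
      by move=> /KD.
    have wphiD x : ~ D x -> w x * phi x = 0 by move=> xD; rewrite wD ?mul0r.
    rewrite (integral_support zD) (integral_support wphiD).
    rewrite (integrable_EFin intz) zE.
    have wphiE x : (w x * phi x) = - (N%:R / rho) * (phi x * \1_B x) by rewrite /w; ring.
    under [in RHS]eq_integral do rewrite wphiE.
    rewrite integrable_EFin; last exact: (integrableZl measurableT _ int_phi).
    rewrite RintegralZl// -EFinN mulNr opprK; congr EFin.
    rewrite -RintegralZl//; apply: eq_Rintegral => x _.
    by rewrite -mulrA; congr (_ * _); exact: mulrC.
  + exact: measurable_funTS.
  + have [M _ BM] := compact_sub_cube (@compact_cball _ _ N_gt0 a (rho ^+ 2)).
    apply: (norm_p_bounded_lty _ mw wD (M := M) _ w_le); first by rewrite ltr0n.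
    by move=> x xM; rewrite /w indicE memNset ?mulr0// => /BM.
- split.
    apply: (trace_zero oD (@closed_cball _ _ N_gt0 a (rho ^+ 2)) BD) => x xB.
    by rewrite /ball_fun indicE memNset ?mulr0.
  rewrite gvE [X in (_ + X)%E]integral0_eq ?adde0; last by move=> x _; rewrite normr0.
  rewrite integral_support; last by move=> x xD; rewrite wD ?mulr0.
  have uwE x : ball_fun a rho c x * w x = - (c * (N%:R / rho)) * \1_B x.
    by rewrite /ball_fun /w; case: (indic_ball x) => -[-> _]; ring.
  have intB := integrable_indic_ball N_gt0 a rho.
  under eq_integral do rewrite uwE.
  rewrite integrable_EFin; last exact: (integrableZl measurableT _ intB).
  by rewrite RintegralZl// -EFinN; congr EFin; ring.
- split.
  + exact: measurable_funTS.
  + apply: norm_p_infty_le => // x _.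
    by case: (indic_ball x) => -[-> _]; rewrite ?normr1 ?normr0.
  + apply: aeW => x _; rewrite /ball_fun.
    by case: (indic_ball x) => -[-> _]; rewrite ?mul0r ?mulr0// mulr1 mul1r ger0_norm// ltW.
- apply: aeW => x _; rewrite /w /ball_fun.
  case: (indic_ball x) => -[-> _]; last by rewrite !mulr0 oppr0 addr0.
  by rewrite !mulr1 (ger0_norm (ltW c_gt0)) opprK addrC -c_eq -!mulrA !powR_sub1.
Qed.

End ball_solution.

Lemma powR_sum_surjective (R : realType) (lambda s p A : R) : 0 < lambda -> 0 < s -> 0 < p -> 0 < A ->
  exists2 c : R, 0 < c & lambda * c `^ s + c `^ p = A.
Proof.
move=> l0 s0 p0 A0; pose f (c : R) := lambda * c `^ s + c `^ p.
(* Endpoints for the intermediate value theorem: at [d] each summand is at most A / 2, and at [e]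
   the second one alone is [A]. As [d] is positive, the powers are differentiable on the whole
   interval. *)
pose d := Num.min ((A / (2 * lambda)) `^ s^-1) ((A / 2) `^ p^-1).
pose e := A `^ p^-1.
have Al0 : 0 < A / (2 * lambda) by rewrite divr_gt0// mulr_gt0.
have A20 : 0 < A / 2 by rewrite divr_gt0.
have d0 : 0 < d by rewrite lt_min !powR_gt0.
have e0 : 0 < e by rewrite powR_gt0.
have powRK (b t : R) : 0 < b -> 0 < t -> (b `^ t^-1) `^ t = b.
  by move=> b0 t0; rewrite -powRrM mulVf ?powRr1 ?ltW// gt_eqF.
have mono (t x y : R) : 0 < t -> 0 <= x -> x <= y -> x `^ t <= y `^ t.
  move=> t0 x0 xy; apply: ge0_ler_powR; rewrite ?nnegrE// ?(ltW t0)//.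
  exact: le_trans xy.
have de : d <= e.
  apply: le_trans (_ : (A / 2) `^ p^-1 <= _); first by rewrite ge_min lexx orbT.
  by apply: mono; rewrite ?invr_gt0 ?(ltW A20)//; lra.
have fd : f d <= A.
  have ds : d `^ s <= A / (2 * lambda).
    by rewrite -(powRK _ s Al0 s0) mono ?(ltW d0)// ge_min lexx.
  have dp : d `^ p <= A / 2.
    by rewrite -(powRK _ p A20 p0) mono ?(ltW d0)// ge_min lexx orbT.
  rewrite /f; have -> : A = lambda * (A / (2 * lambda)) + A / 2 by field; rewrite gt_eqF.
  by rewrite lerD// ler_pM2l.
have fe : A <= f e by rewrite /f /e powRK// lerDr mulr_ge0 ?powR_ge0// ltW.
have cf : {within `[d, e], continuous f}.
  apply: derivable_within_continuous => x; rewrite in_itv/= => /andP[dx _].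
  have x0 : 0 < x by exact: lt_le_trans dx.
  have ds := is_derive1_powR s x0; have dp := is_derive1_powR p x0.
  by apply: derivableD => //; apply: derivableM.
have [|c] := @IVT _ f d e A de cf.
  by rewrite ge_min le_max fd fe orbT.
by rewrite in_itv/= => /andP[dc _] fc; exists c => //; exact: lt_le_trans dc.
Qed.

(** * Balls inside the annulus *)

Section annulus.
Context (R : realType) (N : nat).
Hypothesis N_gt0 : (0 < N)%N.
Local Notation leb := (lebesgueN R N).
Implicit Types (x : 'rV[R]_N).

Lemma open_annulus (r : R) : open (annulus r : set 'rV[R]_N).
Proof.
have ce : continuous (@enorm R N).
  apply: (@continuous_comp_fun _ _ _ (fun x : 'rV[R]_N => \sum_i x 0 i ^+ 2) Num.sqrt).
    apply: continuous_sum => i; apply: continuous_mul; exact: coord_continuous.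
  exact: sqrt_continuous.
have -> : annulus r = (@enorm R N @^-1` [set y | r < y]) `&` (@enorm R N @^-1` [set y | y < r + 1]).
  by apply/seteqP; split => x /= /andP.
by apply: openI; apply: open_comp => [x _|]; [exact: ce|exact: open_gt|exact: ce|exact: open_lt].
Qed.

Let o : 'I_N := Ordinal N_gt0.

Definition annulus_center (r : R) : 'rV[R]_N := \row_j (if j == o then r + 2^-1 else 0).

Let center_o r : annulus_center r 0 o = r + 2^-1. Proof. by rewrite mxE eqxx. Qed.

(** The centre lies on the first axis, so the first coordinate differs from r + 1/2 by at most
    [rho]. This alone bounds |x| from below. Expanding |x - a|^2 expresses |x|^2 through that
    coordinate and gives |x| <= r + 1/2 + rho, without the triangle inequality. *)
Lemma cball_annulus (r rho : R) : 0 < r -> 0 < rho < 2^-1 ->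
  cball (annulus_center r) (rho ^+ 2) `<=` annulus r.
Proof.
move=> r0 /andP[rho0 rho12] x; rewrite /cball /= => xB.
have := coord_le_sqdist (annulus_center r) x o; rewrite center_o => xo.
have sE : \sum_i x 0 i ^+ 2 = sqdist (annulus_center r) x + 2 * (r + 2^-1) * x 0 o - (r + 2^-1) ^+ 2.
  rewrite /sqdist (bigD1 o)//= [in RHS](bigD1 o)//= center_o.
  rewrite (eq_bigr (fun j => (x 0 j - annulus_center r 0 j) ^+ 2)); first by ring.
  by move=> j /negPf jo; rewrite mxE jo subr0.
have xo_le : x 0 o ^+ 2 <= \sum_i x 0 i ^+ 2.
  by rewrite [leRHS](bigD1 o)//= lerDl sumr_ge0// => j _; exact: sqr_ge0.
have xor : - rho <= x 0 o - (r + 2^-1) <= rho.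
  by rewrite -ler_norml -ler_sqr ?nnegrE ?(ltW rho0)// real_normK ?num_real// (le_trans xo).
have /andP[xo1 xo2] := xor.
have lo : r ^+ 2 < enorm x ^+ 2.
  rewrite enorm_sqr; apply: lt_le_trans xo_le.
  by rewrite ltrXn2r ?nnegrE ?(ltW r0)//; lra.
have hi : enorm x ^+ 2 < (r + 1) ^+ 2.
  rewrite enorm_sqr sE; apply: (@le_lt_trans _ _ ((r + 2^-1 + rho) ^+ 2)).
    have : (r + 2^-1) * (x 0 o - (r + 2^-1)) <= (r + 2^-1) * rho by rewrite ler_wpM2l//; lra.
    by move: (x 0 o) (2^-1 : R) => y h; nra.
  by rewrite ltrXn2r ?nnegrE//; lra.
have en0 : 0 <= enorm x by exact: sqrtr_ge0.
apply/andP; split.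
  by rewrite -ltr_sqr ?nnegrE ?(ltW r0).
by rewrite -ltr_sqr ?nnegrE ?addr_ge0 ?(ltW r0).
Qed.

(** The first coordinate is positive on the ball, so the orthogonal map -1 moves the ball off
    itself; this refutes radial symmetry. *)
Lemma cball_annulus_opp (r rho : R) x : 0 < r -> 0 < rho < 2^-1 ->
  cball (annulus_center r) (rho ^+ 2) x -> ~ cball (annulus_center r) (rho ^+ 2) (- x).
Proof.
move=> r0 /andP[rho0 rho12] xB xB'.
have := coord_le_sqdist (annulus_center r) x o; rewrite center_o => xo.
have := coord_le_sqdist (annulus_center r) (- x) o; rewrite center_o mxE => xo'.
have := le_trans xo xB; have := le_trans xo' xB'.
by move: (x 0 o) => y; nra.
Qed.

Lemma ae_ball_exists (a : 'rV[R]_N) (rho : R) (P : 'rV[R]_N -> Prop) : 0 < rho ->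
  (\forall x \ae leb, P x) -> exists2 x, cball a (rho ^+ 2) x & P x.
Proof.
move=> rho0 [A [mA A0 PA]]; apply: contrapT => noP.
have BA : cball a (rho ^+ 2) `<=` A.
  by move=> x xB; apply: PA => /= Px; apply: noP; exists x.
have := lebesgue_cball_gt0 N_gt0 a rho0; rewrite ltNge => /negP; apply.
by rewrite -A0; exact: le_outer_measure.
Qed.

End annulus.

Theorem theorem1p1 (R : realType) (N : nat) (hN : (2 <= N)%N) (hN3 : N <> 3%N)
  (q : R) (hq : 1 < q < crit_exp R N) (n : nat) :
  exists r0 lambda0 : R, 0 < r0 /\ 0 < lambda0 /\
    forall lambda r : R, lambda0 <= lambda -> r0 <= r ->
      exists u : 'I_n -> 'rV[R]_N -> R,
        (forall i, is_solution lambda q (annulus r) (u i) /\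
                   ~ radial (annulus r) (u i)) /\
        (forall i j, i <> j -> ~ rot_equivalent (annulus r) (u i) (u j)).
Proof.
have N_gt0 : (0 < N)%N by exact: leq_trans hN.
have /andP[q1 _] := hq.
have p1 : 1 < crit_exp R N.
  rewrite /crit_exp ltr_pdivlMr ?subr_gt0 ?ltr1n//.
  by rewrite mul1r gtrBl.
exists 1, 1; do 2!split => //; move=> lambda r lambda1 r1.
have r0 : 0 < r by exact: lt_le_trans r1.
pose a := annulus_center N_gt0 r.
(* Indices start at 0, so the radii are distinct and at most 1/3; [rho1], equal to 2/5, fits
   strictly between 1/3 and the half-width 1/2 of the annulus. *)
pose rho (i : 'I_n) : R := (i.+3%:R)^-1.
have rho0 i : 0 < rho i by rewrite invr_gt0 ltr0n.
have rho3 i : rho i <= 3^-1 by rewrite lef_pV2 ?posrE ?ltr0n// ler_nat.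
have rho2 i : 0 < rho i < 2^-1 by rewrite rho0/=; have := rho3 i; lra.
pose rho1 : R := 2 / 5.
have ball1 : cball a (rho1 ^+ 2) `<=` annulus r by apply: cball_annulus => //; rewrite /rho1; lra.
have /choice[c cP] i : exists c : R, 0 < c /\
    lambda * c `^ (q - 1) + c `^ (crit_exp R N - 1) = 1 + N%:R / rho i.
  have [||||c c0 cE] := @powR_sum_surjective R lambda (q - 1) (crit_exp R N - 1) (1 + N%:R / rho i).
  - exact: lt_le_trans lambda1.
  - by rewrite subr_gt0.
  - by rewrite subr_gt0.
  - by rewrite ltr_wpDr// divr_ge0// ltW.
  - by exists c.
have c0 i : 0 < c i by case: (cP i).
have BD i : cball a (rho i ^+ 2) `<=` annulus r by exact: cball_annulus.
exists (fun i => ball_fun a (rho i) (c i)); split=> [i|i j ij].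
  split.
    have rho1i : rho i < rho1 by have := rho3 i; rewrite /rho1; lra.
    exact: (is_solution_ball N_gt0 (rho0 i) rho1i (c0 i) (@open_annulus R N r) ball1 (cP i).2).
  move=> /(_ (- 1%:M)) []; first by rewrite /orthogonal_mx linearN/= trmx1 mulmxN mulNmx opprK mulmx1.
  move=> A rad.
  have [x xB] := ae_ball_exists N_gt0 a (rho0 i) (ex_intro _ A rad).
  move=> /(_ (BD i x xB)); rewrite mulmxN mulmx1 /ball_fun !indicE mem_set// memNset.
    by rewrite mulr1 mulr0 => ci; have := c0 i; rewrite ci ltxx.
  exact: cball_annulus_opp.
move=> [g [_ uij]].
have [x xB] := ae_ball_exists N_gt0 a (rho0 j) uij.
move=> /(_ (BD j x xB)); rewrite /ball_fun !indicE mem_set// mulr1 => cE.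
(* At one point of the ball of [u j] the value [c j] equals a value of [u i], which is [c i] or 0,
   and [c j] is positive. The equation for the heights then gives equal radii. *)
have cji : c j = c i.
  move: cE; case: (_ \in _); rewrite ?mulr1 ?mulr0// => cj0.
  by have := c0 j; rewrite cj0 ltxx.
have Nrho : N%:R / rho j = N%:R / rho i.
  by apply: (@addrI _ 1); rewrite -(cP i).2 -(cP j).2 cji.
apply: ij; apply: val_inj; move: Nrho => /mulfI; rewrite pnatr_eq0 -lt0n => /(_ N_gt0).
by rewrite !invrK => /eqP; rewrite eqr_nat !eqSS => /eqP.
Qed.
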